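(* Let $(X,d)$ be a compact metric space and let $s>0$ be such that $\mathcal{H}^s(X)=1$ and there exist constants $0<c_1<1<c_2<\infty$ and $r_0>0$ with $c_1 r^s\le\mathcal{H}^s(B(x,r))\le c_2 r^s$ for all $x\in X$ and $0<r<r_0$. Suppose $(F_j)_{j\in\mathbb{N}}$ is a sequence of sets in $X$ satisfying the local scaling property (LSP) with respect to some $0\le\kappa<1$ (with $g(r)=r^s$). Let $\Phi$ be a set of isometries of $X$, from which sequences $(\phi_j)_{j\in\mathbb{N}}\in\Phi^{\mathbb{N}}$ are chosen randomly according to a law $\mathbb{P}$ with the following two properties: (1) for any $x\in X$, any $j\in\mathbb{N}$ and $\delta>0$ sufficiently small, $\mathbb{P}(x\in\Delta(\phi_j(F_j),\delta))=\mathcal{H}^s(\Delta(F_j,\delta))$; (2) for any $x\in X$ and any sequence $(\delta_j)_{j\in\mathbb{N}}$ of sufficiently small numbers, the events $E_j=\{x\in\Delta(\phi_j(F_j),\delta_j)\}$, $j\in\mathbb{N}$, are independent, i.e. $\mathbb{P}\big(\bigcap_{j\in S}E_j\big)=\prod_{j\in S}\mathbb{P}(E_j)$ for any finite set $S\subset\mathbb{N}$. Let $\tau>\frac{1}{s-\kappa s}$. Then, for $\mathbb{P}$-almost every $(\phi_j)_{j\in\mathbb{N}}\in\Phi^{\mathbb{N}}$, we have $$\dim_{\mathrm H}\big(\Lambda((\phi_j),(j^{-\tau}))\big)=\kappa s+\frac1\tau\qquad\text{and}\qquad\mathcal{H}^{\kappa s+1/\tau}\big(\Lambda((\phi_j)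,(j^{-\tau}))\big)=\infty.$$
   Context: $\mathcal{H}^t$ denotes $t$-dimensional Hausdorff measure, defined via covers by balls: $\mathcal{H}^t(F)=\lim_{\rho\to0}\inf\{\sum_i r(B_i)^t\}$, the infimum being over countable covers of $F$ by balls $B_i$ of radius $r(B_i)<\rho$. $\dim_{\mathrm H}$ is Hausdorff dimension, $\dim_{\mathrm H}F=\inf\{t\ge0:\mathcal{H}^t(F)=0\}$. For $F\subset X$ and $\delta\ge0$, $\Delta(F,\delta):=\{x\in X:d(x,F)<\delta\}$, where $d(x,F)=\min\{d(x,y):y\in F\}$. LSP with $g(r)=r^s$: $(F_j)_{j\in\mathbb{N}}$ satisfies the LSP with respect to $\kappa$ if there exist constants $c_3,c_4,r_1>0$ such that for any $0<r<r_1$, $\delta<r$, $j\in\mathbb{N}$ and $x\in F_j$, $$c_3\,\delta^{s(1-\kappa)}r^{s\kappa}\le\mathcal{H}^s(B(x,r)\cap\Delta(F_j,\delta))\le c_4\,\delta^{s(1-\kappa)}r^{s\kappa}.$$ Random limsup sets: for a sequence $\Upsilon=(\Upsilon_j)_{j\in\mathbb{N}}$ of non-negative reals and $(\phi_j)_{j\in\mathbb{N}}\in\Phi^{\mathbb{N}}$, $$\Lambda((\phi_j),\Upsilon):=\{x\in X: x\in\Delta(\phi_j(F_j),\Upsilon_j)\text{ for infinitely many }j\in\mathbb{N}\}.$$ $(j^{-\tau})$ denotes the sequence $\Upsilon_j=j^{-\tau}$. *)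

(* Defs.v *)
From HB Require Import structures.
From mathcomp Require Import all_boot all_order all_algebra finmap.
From mathcomp Require Import all_classical all_reals all_analysis.

Set Implicit Arguments.
Unset Strict Implicit.
Unset Printing Implicit Defensive.

Import Order.TTheory GRing.Theory Num.Theory.
Import numFieldNormedType.Exports.

Local Open Scope classical_set_scope.
Local Open Scope ring_scope.

Section metric_space.
Context {R : realType} {X : metricType R}.

(* A ball is recorded as a pair (centre, radius), since as a set it need not
   determine its radius. *)
Definition ball_cover (rho : R) (F : set X) (B : set (X * R)) : Prop :=
  [/\ countable B,
      forall b, B b -> 0 < b.2 < rho &
      F `<=` \bigcup_(b in B) ball b.1 b.2].

Definition hausdorff_content (t rho : R) (F : set X) : \bar R :=
  ereal_inf [set (\esum_(b in B) (b.2 `^ t)%:E)%E | B in ball_cover rho F].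

Definition hausdorff_measure (t : R) (F : set X) : \bar R :=
  lim (hausdorff_content t rho F @[rho --> 0^'+]).

Definition hausdorff_dim (F : set X) : \bar R :=
  ereal_inf [set t%:E | t in [set t | 0 <= t /\ hausdorff_measure t F = 0%E]].

(* edist_inf F x is the infimum of the distances from x to the points of F
   (+oo if F is empty); it is the minimum whenever the latter exists. *)
Definition Delta (F : set X) (delta : R) : set X :=
  [set x | (edist_inf F x < delta%:E)%E].

Definition local_scaling_property (s kappa : R) (F : nat -> set X) : Prop :=
  exists c3 c4 r1 : R, [/\ 0 < c3, 0 < c4, 0 < r1 &
    forall (r delta : R) (j : nat) (x : X),
      0 < r < r1 -> 0 <= delta < r -> F j x ->
      ((c3 * delta `^ (s * (1 - kappa)) * r `^ (s * kappa))%:E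
         <= hausdorff_measure s (ball x r `&` Delta (F j) delta)
         <= (c4 * delta `^ (s * (1 - kappa)) * r `^ (s * kappa))%:E)%E].

Definition is_isometry (f : X -> X) : Prop :=
  forall x y, mdist (f x) (f y) = mdist x y.

Definition Lambda (F : nat -> set X) (phi : nat -> X -> X) (Upsilon : nat -> R) :
    set X :=
  [set x | infinite_set [set j | Delta (phi j @` F j) (Upsilon j) x]].

End metric_space.

Definition independent_events {R : realType} {d : measure_display}
    {Omega : measurableType d} (P : probability Omega R)
    (E : nat -> set Omega) : Prop :=
  (forall j, measurable (E j)) /\
  forall S : {fset nat},
    P (\bigcap_(j in [set` S]) E j) = (\prod_(j <- S) P (E j))%E.

(* Main.v *)
(* Write a = s kappa, b = s (1 - kappa) and t = a + 1/tau, let A_j be the random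
   set phi_j(F_j), and put r_j = j^(-1/b) and d_j = j^(-tau), so that
   d_j^(1/tau) = r_j^b = 1/j.  The LSP says that A_j has about (r/e)^a points at
   mutual distance e in each ball of radius r centred on A_j.  This gives
   H^q(Lambda) = 0 for q > t at once.

   A point x is r_j-close to A_j with probability at least of order 1/j.  These
   events are independent for fixed x and their probabilities have a divergent
   sum, so almost surely every ball contains, for every n, disjoint balls
   B(z, r_j) with z in A_j and j >= n that fill a fixed proportion of it.

   It remains to see that such a Lambda cannot have a cover by balls B(y_i, rho_i)
   with sum of rho_i^t finite, all rho_i being small.  Call B(z, R) lightly covered if
   the balls of the cover that meet it satisfy sum rho_i^t <= eps R^t.  Then they
   occupy at most half of B(z, R/2), and the rest still has a definite measure
   after deleting finitely many of them; the remaining ones have an arbitrarily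
   small sum.  Inside each disjoint ball B(z', r_j) of the rest take about
   (r_j/d_j)^a separated balls of radius d_j centred on A_j.  If none of all these
   balls were lightly covered, then, since (r_j/d_j)^a d_j^t = r_j^s, the sum of
   rho_i^t would be bounded below by the measure of the rest, a contradiction.
   Iterating yields nested lightly covered balls B(z_k, d_(j_k)) whose common point
   belongs to Lambda, hence to one ball of the cover, whose radius would have to
   be 0. *)
Require Import Defs.
From HB Require Import structures.
From mathcomp Require Import all_boot all_order all_algebra finmap.
From mathcomp Require Import all_classical all_reals all_analysis.
From mathcomp Require Import measurable_realfun ring lra.

Set Implicit Arguments.
Unset Strict Implicit.
Unset Printing Implicit Defensive.

Import Order.TTheory GRing.Theory Num.Theory.
Import numFieldNormedType.Exports.

Local Open Scope classical_set_scope.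
Local Open Scope ring_scope.

(** * Hausdorff measure as a metric outer measure *)

Section hausdorff_outer_measure.
Context {R : realType} {X : metricType R}.
Implicit Types (F : set X) (t rho : R).

(** A strict bound on an infimum is witnessed by a point, whether or not the distance is
    attained. *)
Lemma DeltaP F delta x :
  Delta F delta x <-> exists2 y, F y & mdist x y < delta.
Proof.
split.
  case/ereal_inf_lt => _ [y Fy <-] /edist_lt_ball /=.
  by rewrite ballEmdist /= => xy; exists y.
move=> [y Fy xy]; rewrite /Delta /=.
(* [edist] is bounded through balls containing the point, so a radius strictly between the distance
   and [delta] keeps the final inequality strict. *)
pose r := (mdist x y + delta) / 2.
have r1 : mdist x y < r by rewrite /r; lra.
have r2 : r < delta by rewrite /r; lra.
have r0 : 0 < r by apply: le_lt_trans r1; exact: mdist_ge0.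
apply: (@le_lt_trans _ _ r%:E); last by rewrite lte_fin.
apply: (@le_trans _ _ (edist (x, y))); last first.
  by apply: edist_fin => //; rewrite ballEmdist.
by apply: ereal_inf_lbound; exists y.
Qed.

Lemma ballP (x : X) r y : ball x r y <-> mdist x y < r.
Proof. by rewrite ballEmdist. Qed.

Lemma hausdorff_content_ge0 t rho F : (0 <= hausdorff_content t rho F)%E.
Proof.
apply: le_ereal_inf_tmp => _ [B _ <-]; apply: esum_ge0 => b _.
by rewrite lee_fin powR_ge0.
Qed.

Lemma hausdorff_content0 t rho : hausdorff_content t rho (set0 : set X) = 0%E.
Proof.
apply/eqP; rewrite eq_le hausdorff_content_ge0 andbT.
apply: ereal_inf_lbound; exists set0; last by rewrite esum_set0.
by split => //; exact: sub0set.
Qed.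

Lemma le_hausdorff_content t rho :
  {homo @hausdorff_content R X t rho : A B / A `<=` B >-> (A <= B)%E}.
Proof.
move=> A B AB; apply: ereal_inf_le_tmp => _ [C [C1 C2 C3] <-]; exists C => //.
by split => //; exact: subset_trans C3.
Qed.

Lemma ge_hausdorff_content t F :
  {homo (fun rho => hausdorff_content t rho F) : r r' / r <= r' >-> (r' <= r)%E}.
Proof.
move=> r r' rr'; apply: ereal_inf_le_tmp => _ [C [C1 C2 C3] <-]; exists C => //.
by split => // b /C2/andP[-> /lt_le_trans]; exact.
Qed.

Lemma le_esum_set (T : choiceType) (I J : set T) (a : T -> \bar R) :
  I `<=` J -> (esum I a <= esum J a)%E.
Proof.
move=> IJ; apply: ge_ereal_sup => _ [A [fA AI] <-]; apply: ereal_sup_ubound; exists A => //.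
by split => //; exact: subset_trans IJ.
Qed.

(** Near-optimal covers with excess e / 2^(n+1) for the n-th set combine to a cover of the union. *)
Lemma hausdorff_content_sigma_subadditive t rho :
  sigma_subadditive (@hausdorff_content R X t rho).
Proof.
move=> F.
(* If one content is infinite the bound is trivial; otherwise near-optimal covers exist. *)
have [[n Fn]|/forallNP Fn] := pselect (exists n, hausdorff_content t rho (F n) = +oo%E).
  suff -> : (\sum_(i <oo) hausdorff_content t rho (F i) = +oo)%E by rewrite leey.
  apply/eqP; rewrite -leye_eq -Fn.
  apply: le_trans (nneseries_lim_ge n.+1 _).
    rewrite big_nat_recr //= leeDr // sume_ge0 // => i _.
    exact: hausdorff_content_ge0.
  by move=> i _ _; exact: hausdorff_content_ge0.
apply/lee_addgt0Pr => e e0.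
have /choice[B BP] : forall n, exists B, ball_cover rho (F n) B /\
    (\esum_(b in B) (b.2 `^ t)%:E <=
       hausdorff_content t rho (F n) + (e / (2 ^ n.+1)%:R)%:E)%E.
  move=> n.
  have fn : (hausdorff_content t rho (F n) \is a fin_num)%E.
    by rewrite ge0_fin_numE ?hausdorff_content_ge0 // ltey; apply/eqP/Fn.
  have e1 : (0 < e / (2 ^ n.+1)%:R)%R by rewrite divr_gt0 // ltr0n expn_gt0.
  have [_ [B ? <-] h] := lb_ereal_inf_adherent e1 fn.
  by exists B; split => //; exact: ltW.
apply: le_trans (epsilon_trick _ _ (ltW e0)); last first.
  by move=> n; exact: hausdorff_content_ge0.
apply: (@le_trans _ _ (\sum_(n <oo) \esum_(b in B n) (b.2 `^ t)%:E)%E); last first.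
  apply: lee_nneseries => n _; last exact: (BP n).2.
  by move=> *; apply: esum_ge0 => b _; rewrite lee_fin powR_ge0.
apply: (@le_trans _ _ (\esum_(b in \bigcup_n B n) (b.2 `^ t)%:E)%E).
  apply: ereal_inf_lbound; exists (\bigcup_n B n) => //; split.
  - by apply: bigcup_countable => // n _; case: (BP n) => -[].
  - by move=> b [n _]; case: (BP n) => -[_ + _] _; exact.
  - move=> x [n _ Fnx]; case: (BP n) => -[_ _ /(_ _ Fnx)[b Bb xb] _].
    by exists b => //; exists n.
(* A ball may belong to several covers; making them disjoint counts it once, which only lowers the
   sum. *)
rewrite seqDU_bigcup_eq esum_bigcupT; last 2 first.
- exact: trivIset_seqDU.
- by move=> b; rewrite lee_fin powR_ge0.
rewrite nneseries_esumT; last first.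
  by move=> n; apply: esum_ge0 => b _; rewrite lee_fin powR_ge0.
apply: le_esum => n _; apply: le_esum_set; exact: subset_seqDU.
Qed.

Lemma hausdorff_measureE t F : hausdorff_measure t F =
  ereal_sup [set hausdorff_content t rho F | rho in [set r | 0 < r]].
Proof.
apply/cvg_lim => //.
have -> : [set rho : R | 0 < rho] = [set` Interval (BRight 0) +oo%O].
  by apply/seteqP; split => x /=; rewrite in_itv /= andbT.
apply: nonincreasing_at_right_cvge => //.
by move=> r r' _ _; exact: ge_hausdorff_content.
Qed.

Lemma hausdorff_content_le t rho F :
  0 < rho -> (hausdorff_content t rho F <= hausdorff_measure t F)%E.
Proof. by move=> r0; rewrite hausdorff_measureE; apply: ereal_sup_ubound; exists rho. Qed.

Lemma hausdorff_measure_le t F y :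
  (forall rho : R, 0 < rho -> (hausdorff_content t rho F <= y)%E) ->
  (hausdorff_measure t F <= y)%E.
Proof. by move=> h; rewrite hausdorff_measureE; apply: ge_ereal_sup => _ [r /h ? <-]. Qed.

Lemma hausdorff_measure0 t : hausdorff_measure t (set0 : set X) = 0%E.
Proof.
apply/eqP; rewrite eq_le; apply/andP; split.
  by apply: hausdorff_measure_le => r _; rewrite hausdorff_content0.
by apply: le_trans (hausdorff_content_le _ _ ltr01); exact: hausdorff_content_ge0.
Qed.

Lemma hausdorff_measure_ge0 t F : (0 <= hausdorff_measure t F)%E.
Proof.
by apply: le_trans (hausdorff_content_le _ _ ltr01); exact: hausdorff_content_ge0.
Qed.

Lemma le_hausdorff_measure t :
  {homo @hausdorff_measure R X t : A B / A `<=` B >-> (A <= B)%E}.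
Proof.
move=> A B AB; apply: hausdorff_measure_le => r r0.
by apply: le_trans (hausdorff_content_le _ _ r0); exact: le_hausdorff_content.
Qed.

Lemma hausdorff_measure_sigma_subadditive t :
  sigma_subadditive (@hausdorff_measure R X t).
Proof.
move=> F; apply: hausdorff_measure_le => r r0.
apply: le_trans (hausdorff_content_sigma_subadditive _ _ _) _.
apply: lee_nneseries => n _; first by move=> *; exact: hausdorff_content_ge0.
exact: hausdorff_content_le.
Qed.

HB.instance Definition _ t := isOuterMeasure.Build R X (@hausdorff_measure R X t)
  (hausdorff_measure0 t) (hausdorff_measure_ge0 t) (@le_hausdorff_measure t)
  (@hausdorff_measure_sigma_subadditive t).

(** The content at a fixed scale is an outer measure too; the upper bound for the limsup set
    estimates tails of unions with it. *)
HB.instance Definition _ t rho := isOuterMeasure.Build R X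
  (@hausdorff_content R X t rho)
  (hausdorff_content0 t rho) (hausdorff_content_ge0 t rho)
  (@le_hausdorff_content t rho) (@hausdorff_content_sigma_subadditive t rho).

Lemma hausdorff_content_ball t rho (x : X) (r : R) :
  0 < r < rho -> (hausdorff_content t rho (ball x r) <= (r `^ t)%:E)%E.
Proof.
move=> r0; apply: ereal_inf_lbound; exists [set (x, r)].
  by split => //; [move=> _ ->|move=> y xy; exists (x, r)].
by rewrite esum_set1 // lee_fin powR_ge0.
Qed.

(** A ball of radius below [rho] cannot meet both sets, so every cover of the union splits into a
    cover of [A] and one of [B]. *)
Lemma hausdorff_content_separated t rho (A B : set X) :
  (forall x y, A x -> B y -> 2 * rho <= mdist x y) ->
  (hausdorff_content t rho A + hausdorff_content t rho B
   <= hausdorff_content t rho (A `|` B))%E.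
Proof.
move=> AB; apply: le_ereal_inf_tmp => _ [C [C1 C2 C3] <-].
pose D := [set b : X * R | exists2 x, A x & ball b.1 b.2 x].
rewrite (esumID D) //; last by move=> b _; rewrite lee_fin powR_ge0.
apply: leeD; apply: ereal_inf_lbound; eexists; try reflexivity; split.
- by apply: sub_countable C1; apply: subset_card_le => ? [].
- by move=> b [/C2].
- move=> x Ax; have [b Cb xb] : (\bigcup_(b in C) ball b.1 b.2) x by apply: C3; left.
  by exists b => //; split => //; exists x.
- by apply: sub_countable C1; apply: subset_card_le => ? [].
- by move=> b [/C2].
- move=> y By; have [b Cb yb] : (\bigcup_(b in C) ball b.1 b.2) y by apply: C3; right.
  exists b => //; split => // -[x Ax xb].
  have := AB _ _ Ax By; rewrite leNgt => /negP; apply.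
  have /andP[b0 brho] := C2 _ Cb.
  move: xb yb; rewrite !ballEmdist /= => xb yb.
  have := metric_triangle x b.1 y; rewrite (metric_sym x b.1); lra.
Qed.

Lemma hausdorff_measure_separated t (A B : set X) (e : R) : 0 < e ->
  (forall x y, A x -> B y -> e <= mdist x y) ->
  (hausdorff_measure t A + hausdorff_measure t B
   <= hausdorff_measure t (A `|` B))%E.
Proof.
move=> e0 AB.
(* Independent scales for the two sets allow the two suprema to be taken one after the other. *)
have h r r' : 0 < r -> 0 < r' -> (hausdorff_content t r A + hausdorff_content t r' B
   <= hausdorff_measure t (A `|` B))%E.
  move=> r0 r'0; pose m := Num.min (Num.min r r') (e / 2).
  have m0 : 0 < m by rewrite /m !lt_min r0 r'0 divr_gt0.
  have mr : m <= r by rewrite /m !ge_min lexx.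
  have mr' : m <= r' by rewrite /m !ge_min lexx orbT.
  have me : 2 * m <= e by rewrite mulrC -ler_pdivlMr // /m !ge_min lexx orbT.
  apply: le_trans (hausdorff_content_le _ _ m0).
  apply: le_trans (hausdorff_content_separated _ _); last first.
    by move=> x y Ax By; apply: le_trans (AB _ _ Ax By).
  by apply: leeD; exact: ge_hausdorff_content.
have [->|Moo] := eqVneq (hausdorff_measure t (A `|` B)) +oo%E; first by rewrite leey.
have fin (F : \bar R) : (0 <= F)%E -> (F <= hausdorff_measure t (A `|` B))%E -> F \is a fin_num.
  by move=> F0 FM; rewrite ge0_fin_numE // (le_lt_trans FM) // ltey.
have fA : hausdorff_measure t A \is a fin_num.
  by apply: fin; [exact: hausdorff_measure_ge0|apply: le_hausdorff_measure => x; left].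
have fB : hausdorff_measure t B \is a fin_num.
  by apply: fin; [exact: hausdorff_measure_ge0|apply: le_hausdorff_measure => x; right].
rewrite -leeBrDr //; apply: hausdorff_measure_le => r r0.
rewrite leeBrDr // addeC -leeBrDr; last first.
  apply: fin; first exact: hausdorff_content_ge0.
  apply: le_trans (hausdorff_content_le _ _ r0) _.
  by apply: le_hausdorff_measure => x; left.
apply: hausdorff_measure_le => r' r'0; rewrite leeBrDr; first by rewrite addeC; exact: h.
apply: fin; first exact: hausdorff_content_ge0.
apply: le_trans (hausdorff_content_le _ _ r0) _.
by apply: le_hausdorff_measure => x; left.
Qed.

End hausdorff_outer_measure.

(** * Carathéodory measurability of closed sets *)

Section hausdorff_caratheodory.
Context {R : realType} {X : metricType R} (t : R).
Local Notation H := (@hausdorff_measure R X t).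

Lemma hausdorff_measure_sum_separated (I : eqType) (s : seq I) (A : I -> set X)
    (W : set X) (e : R) : 0 < e -> uniq s ->
  (forall i j, i \in s -> j \in s -> i != j ->
     forall x y, A i x -> A j y -> e <= mdist x y) ->
  (forall i, i \in s -> A i `<=` W) ->
  (\sum_(i <- s) H (A i) <= H W)%E.
Proof.
move=> e0; elim: s W => [|i s ih] W.
  by move=> *; rewrite big_nil; exact: hausdorff_measure_ge0.
move=> /= /andP[is_ us] sep AW; rewrite big_cons.
pose W' := [set x | exists2 j, j \in s & A j x].
apply: (@le_trans _ _ (H (A i) + H W')%E).
  apply: leeD2l; apply: ih => //.
    by move=> j k js ks; apply: sep; rewrite inE ?js ?ks orbT.
  by move=> j js x Ajx; exists j.
apply: (@le_trans _ _ (H (A i `|` W'))).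
  apply: (@hausdorff_measure_separated _ _ _ _ _ e) => // x y Aix [j js Ajy].
  apply: (sep i j) => //; rewrite ?inE ?eqxx ?js ?orbT //.
  by apply: contraNneq is_ => ->.
apply: le_hausdorff_measure => x [Aix|[j js Ajx]].
  by apply: (AW i) => //; rewrite inE eqxx.
by apply: (AW j) => //; rewrite inE js orbT.
Qed.

(* The shells D n at distance about 1/n from G are separated as soon as their
   indices differ by two, so the sum of their measures converges. *)
Lemma closed_hausdorff_caratheodory (G : set X) : closed G ->
  caratheodory_measurable H G.
Proof.
move=> clG; apply: le_caratheodory_measurable => T /=.
have [->|Too] := eqVneq (H T) +oo%E; first by rewrite leey.
have finT : H T \is a fin_num by rewrite ge0_fin_numE ?hausdorff_measure_ge0 // ltey.
pose T_ n := T `&` [set x | forall g, G g -> n.+1%:R^-1 <= mdist x g].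
pose D n := T_ n.+1 `\` T_ n.
have invle m n : (m <= n)%N -> n.+1%:R^-1 <= m.+1%:R^-1 :> R.
  by move=> mn; rewrite lef_pV2 ?posrE ?ltr0n // ler_nat.
have T_mono m n : (m <= n)%N -> T_ m `<=` T_ n.
  by move=> mn x [Tx h]; split => // g /h; apply: le_trans; exact: invle.
(* Points of [D k] are at distance at least 1/(k+2) from [G], while a point of [D l] is within
   1/(k+3) of some point of [G]. The difference is 1/((k+2)(k+3)), bounded below uniformly for k <
   N. *)
have gap N k l : (k < N)%N -> (k.+1 < l)%N ->
    forall x y, D k x -> D l y -> (N.+2%:R * N.+3%:R)^-1 <= mdist x y.
  move=> kN kl x y [[Tx hx] _] [[Ty hy] /not_andP[//|/existsNP[g /not_implyP[Gg]]]].
  move/negP; rewrite -ltNge => yg.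
  have xg := hx g Gg.
  have yg' : mdist y g < k.+3%:R^-1 by apply: lt_le_trans yg _; exact: invle.
  have tri := metric_triangle x y g.
  have h1 : k.+2%:R^-1 - k.+3%:R^-1 <= mdist x y.
    rewrite lerBlDr; apply: le_trans xg _; apply: le_trans tri _.
    by rewrite lerD2l ltW.
  apply: le_trans h1.
  have -> : k.+2%:R^-1 - k.+3%:R^-1 = (k.+2%:R * k.+3%:R)^-1 :> R.
    have -> : k.+3%:R = k.+2%:R + 1 :> R by rewrite natr1.
    have : 0 < k.+2%:R :> R by [].
    move: (k.+2%:R : R) => u u0.
    have u1 : u + 1 != 0 by rewrite gt_eqF // ltr_wpDr.
    by field; rewrite u1 gt_eqF.
  rewrite lef_pV2 ?posrE ?mulr_gt0 ?ltr0n //.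
  by rewrite ler_pM ?ler0n // ler_nat !ltnS ltnW.
(* Used for the odd and for the even indices: each half of the shells is a separated family inside
   [T]. *)
have half (p : pred nat) N : (forall k l, p k -> p l -> (k < l)%N -> (k.+1 < l)%N) ->
    (\sum_(0 <= k < N | p k) H (D k) <= H T)%E.
  move=> hp; rewrite -big_filter.
  apply: (@hausdorff_measure_sum_separated _ _ _ _ (N.+2%:R * N.+3%:R)^-1).
  - by rewrite invr_gt0 mulr_gt0 ?ltr0n.
  - by rewrite filter_uniq // iota_uniq.
  - move=> k l; rewrite !mem_filter !mem_index_iota => /andP[pk kN] /andP[pl lN] kl x y.
    have [kl'|lk] := ltnP k l; first by apply: gap => //; exact: hp.
    move=> Dx Dy; rewrite metric_sym; move: Dy Dx; apply: gap => //.
    by apply: hp => //; rewrite ltn_neqAle eq_sym kl.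
  - by move=> k _ x [[]].
have sumD : (\sum_(k <oo) H (D k) < +oo)%E.
  apply: (@le_lt_trans _ _ (H T + H T)%E); last by rewrite -ge0_fin_numE ?fin_numD ?finT // adde_ge0 ?hausdorff_measure_ge0.
  apply: lime_le; first by apply: is_cvg_nneseries => *; exact: hausdorff_measure_ge0.
  apply: nearW => N; rewrite (bigID odd) /=; apply: leeD; apply: half => k l.
    by move=> ok ol kl; rewrite ltn_neqAle kl andbT; apply: contraTneq ol => <-; rewrite /= ok.
  by move=> ok ol kl; rewrite ltn_neqAle kl andbT; apply: contraNneq ol => <-; rewrite /= ok.
apply/lee_addgt0Pr => e e0.
have /(_ e e0)[n tail] : forall e, 0 < e -> exists n, (\sum_(n <= k <oo) H (D k) <= e%:E)%E.
  move=> {}e {}e0.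
  have := nneseries_tail_cvg sumD (fun k _ => hausdorff_measure_ge0 t (D k)).
  move=> /fine_cvgP[fin /cvgrPdist_le/(_ _ e0) h].
  near \oo => n; exists n.
  have fn : ((\sum_(n <= k <oo) H (D k)) \is a fin_num)%E by near: n.
  have : `|0 - fine (\sum_(n <= k <oo) H (D k))%E| <= e by near: n.
  by rewrite sub0r normrN -(fineK fn) lee_fin; apply: le_trans; exact: ler_norm.
apply: (@le_trans _ _ (H (T `&` G) + (H (T_ n) + e%:E))%E).
  apply: leeD2l; apply: (@le_trans _ _ (H (T_ n `|` \bigcup_(k in ~` `I_n) D k))).
    apply: le_hausdorff_measure => x [Tx Gx].
    (* Closedness enters here: a point outside [G] has positive distance to it, so lies in some
       [T_ m]. If it is not in [T_ n], the first index at which it appears puts it in a shell [D k]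
       with k >= n. *)
    have : nbhs x (~` G) by apply: open_nbhs_nbhs; split => //; exact: closed_openC.
    rewrite -nbhs_ballE => -[r /= r0 xr].
    have [m mr] : exists m, m.+1%:R^-1 <= r.
      near \oo => m; exists m; apply: ltW; near: m; exact: near_infty_natSinv_lt (PosNum r0).
    have Tm : T_ m x.
      split => // g Gg; apply: le_trans mr _; rewrite leNgt; apply/negP => xg.
      by apply: (xr g) => //; apply/ballP.
    have [mn|nm] := leqP m n; first by left; apply: T_mono Tm.
    have [] := pselect (T_ n x); first by left.
    move=> nTn; right.
    elim: m nm {mr} Tm => // m ih; rewrite ltnS leq_eqVlt => /orP[/eqP <-|nm] Tm.
      by exists n => //=; rewrite ltnn.
    have [/(ih nm)//|nTm] := pselect (T_ m x).
    by exists m => //=; apply/negP; rewrite -leqNgt ltnW.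
  apply: le_trans (outer_measureU2 _ _ _) _; apply: leeD2l.
  apply: le_trans tail; exact: outer_measure_sigma_subadditive_tail.
rewrite addeA; apply: leeD2r.
apply: (@le_trans _ _ (H ((T `&` G) `|` T_ n))); last first.
  by apply: le_hausdorff_measure => x [[]|[]].
apply: (@hausdorff_measure_separated _ _ _ _ _ n.+1%:R^-1); first by rewrite invr_gt0 ltr0n.
by move=> x y [_ Gx] [_ /(_ x Gx)]; rewrite metric_sym.
Unshelve. all: by end_near. Qed.

(* The sets Y n, on which some threshold is at least 1/n, need not be measurable;
   their closures are, and have the same nets. *)
Lemma hausdorff_measure_closure_cover (Y : nat -> set X) (B : set X) (r : \bar R) :
  (forall m n, (m <= n)%N -> Y m `<=` Y n) -> \bigcup_n Y n = setT ->
  (r < H B)%E -> exists n, (r < H (B `&` closure (Y n)))%E.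
Proof.
move=> Ymono Ycover rB.
pose G n := closure (Y n); pose D := seqD G.
have mono : nondecreasing_seq G.
  by move=> m n mn; apply/subsetPset; exact/closure_subset/Ymono.
have MG n : caratheodory_measurable H (G n).
  by apply: closed_hausdorff_caratheodory; exact: closed_closure.
have MD n : caratheodory_measurable H (D n).
  by case: n => [|n] /=; [exact: MG|apply: caratheodory_measurable_setD; exact: MG].
have tD : trivIset setT D by exact: trivIset_seqD.
have DT : \bigcup_n D n = setT.
  rewrite eq_bigcup_seqD; apply/seteqP; split => // x _.
  have : (\bigcup_n Y n) x by rewrite Ycover.
  by move=> [n _ Yx]; exists n => //; exact: subset_closure.
have : (r < \sum_(k <oo) H (B `&` D k))%E.
  apply: (lt_le_trans rB).
  by have := outer_measure_bigcup_lim H D B; rewrite DT setIT.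
rewrite (_ : (\sum_(k <oo) _)%E = ereal_sup
    (range (fun n => \sum_(0 <= k < n) H (B `&` D k))%E)); last first.
  apply/cvg_lim => //; apply: ereal_nondecreasing_cvgn.
  by apply: ereal_nondecreasing_series => *; exact: hausdorff_measure_ge0.
move=> /ereal_sup_gt[_ [n _ <-] rn]; exists n; apply: (lt_le_trans rn).
(* Measurability of the pieces turns the partial sum back into the measure of one set, the trace of
   [B] on a finite union contained in [G n]. *)
rewrite big_mkord -(caratheodory_additive MD tD) -/(G n).
rewrite -(nondecreasing_bigsetU_seqD n mono); apply: le_hausdorff_measure.
by apply: setIS; apply: subset_bigsetU.
Qed.

End hausdorff_caratheodory.

(** * Separated nets and the local scaling property *)

Section packing.
Context {R : realType} {X : metricType R}.

Definition dispersed (e : R) (xs : seq X) : Prop :=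
  uniq xs /\ {in xs &, forall x y, x != y -> e <= mdist x y}.

Context (s c1 c2 r0 : R).
Local Notation H := (@hausdorff_measure R X s).
Local Notation m := (fun A : set X => fine (H A)).
Context (c1_gt0 : 0 < c1) (HX : H setT = 1%E)
  (ahlfors : forall (x : X) (r : R), 0 < r < r0 ->
     ((c1 * r `^ s)%:E <= H (ball x r) <= (c2 * r `^ s)%:E)%E).

Lemma hausdorff_fin A : H A \is a fin_num.
Proof.
rewrite ge0_fin_numE ?hausdorff_measure_ge0 //.
apply: (@le_lt_trans _ _ 1%E); last exact: ltry.
by rewrite -HX; exact: le_hausdorff_measure.
Qed.
Local Hint Resolve hausdorff_fin : core.

Lemma fine_hausdorff_cover (I : eqType) (u : seq I) (A : I -> set X) W :
  (forall x, W x -> exists2 i, i \in u & A i x) -> m W <= \sum_(i <- u) m (A i).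
Proof.
elim: u W => [|i u ih] W WA.
  rewrite big_nil (_ : W = set0) ?hausdorff_measure0 //.
  by apply/seteqP; split => // x /WA[].
rewrite big_cons -lee_fin EFinD !fineK //.
apply: (@le_trans _ _ (H (A i) + H (W `\` A i))%E).
  apply: le_trans (outer_measureU2 _ _ _); apply: le_hausdorff_measure => x Wx.
  by have [|] := pselect (A i x); [left|right].
apply: leeD2l; rewrite -(fineK (hausdorff_fin (W `\` A i))) lee_fin; apply: ih => x [Wx Aix].
by have [j] := WA _ Wx; rewrite inE => /predU1P[-> //|ju Ajx]; exists j.
Qed.

Lemma ahlfors_ge x (r : R) : 0 < r < r0 -> c1 * r `^ s <= m (ball x r).
Proof. by move=> /(ahlfors x)/andP[+ _]; rewrite -lee_fin fineK. Qed.

Lemma ahlfors_le x (r : R) : 0 < r < r0 -> m (ball x r) <= c2 * r `^ s.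
Proof. by move=> /(ahlfors x)/andP[_]; rewrite -[in X in _ -> X]lee_fin fineK. Qed.

(** Halving the radii of finitely many disjoint balls makes them separated by the least half radius,
    so additivity over separated sets applies. *)
Lemma sum_disjoint_balls (I : eqType) (u : seq I) (p : I -> X) (rho : I -> R) W :
  uniq u -> (forall i, i \in u -> 0 < rho i < 2 * r0) ->
  (forall i j x, i \in u -> j \in u -> mdist (p i) x < rho i ->
     mdist (p j) x < rho j -> i = j) ->
  (forall i, i \in u -> ball (p i) (rho i / 2) `<=` W) ->
  \sum_(i <- u) c1 * (rho i / 2) `^ s <= m W.
Proof.
move=> uu rho0 disj pW.
have [e e0 erho] : exists2 e, 0 < e & forall i, i \in u -> e <= rho i / 2.
  elim: u rho0 {uu disj pW} => [|i u ih] rho0; first by exists 1.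
  have [|e e0 he] := ih; first by move=> j ju; apply: rho0; rewrite inE ju orbT.
  have /andP[ri _] : 0 < rho i < 2 * r0 by apply: rho0; rewrite inE eqxx.
  exists (Num.min e (rho i / 2)); first by rewrite lt_min e0 divr_gt0.
  move=> j; rewrite inE ge_min => /predU1P[->|/he ->//].
  by rewrite lexx orbT.
have half i : i \in u -> 0 < rho i / 2 < r0.
  by move=> /rho0; lra.
apply: (@le_trans _ _ (\sum_(i <- u) m (ball (p i) (rho i / 2)))).
  rewrite big_seq [leRHS]big_seq; apply: ler_sum => i iu.
  by apply: ahlfors_ge; exact: half.
rewrite -lee_fin -sumEFin fineK //.
under eq_bigr do rewrite fineK //.
apply: (@hausdorff_measure_sum_separated _ _ _ _ _ _ _ e) => // i j iu ju ij x y.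
rewrite !ballEmdist /= => px py; rewrite leNgt; apply/negP => xy.
move/eqP: ij; apply; apply: (disj i j y) => //; last by have := half _ ju; lra.
have := metric_triangle (p i) x y; have := erho _ iu; lra.
Qed.

(** Balls of radius e/2 about the points are disjoint; the quarter comes from halving them once
    more. *)
Lemma dispersed_size (e : R) (xs : seq X) W : 0 < e -> e < r0 -> dispersed e xs ->
  (forall x, x \in xs -> ball x (e / 4) `<=` W) ->
  (size xs)%:R * (c1 * (e / 4) `^ s) <= m W.
Proof.
move=> e0 er [uxs dxs] xW.
have -> : (size xs)%:R * (c1 * (e / 4) `^ s) =
    \sum_(x <- xs) (c1 * ((e / 2) / 2) `^ s).
  rewrite big_const_seq count_predT iter_addr_0 mulr_natl.
  by congr (c1 * _ `^ s *+ _); field.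
apply: (sum_disjoint_balls (p := id)) => //.
- by move=> _ _; lra.
- move=> x y z xx yy /= xz yz; apply/eqP; apply: contraT => xy.
  have := dxs x y xx yy xy; have := metric_triangle x z y.
  rewrite (metric_sym z y); lra.
- by move=> x /xW; rewrite (_ : e / 2 / 2 = e / 4) //; field.
Qed.

(** A maximal separated list is a net. Were there none, separated lists of every length would exist,
    against the total mass 1. *)
Lemma exists_net (e : R) (W : set X) : 0 < e -> e < r0 ->
  exists xs : seq X, [/\ dispersed e xs, forall x, x \in xs -> W x &
    forall y, W y -> exists2 x, x \in xs & mdist x y < e].
Proof.
move=> e0 er; apply: contrapT => nex.
have grow n : exists xs : seq X, [/\ dispersed e xs, forall x, x \in xs -> W x &
    size xs = n].
  elim: n => [|n [xs [dxs xsW sxs]]]; first by exists [::]; do !split.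
  have [y Wy yfar] : exists2 y, W y & forall x, x \in xs -> e <= mdist x y.
    apply: contrapT => ny; apply: nex; exists xs; split => // y Wy.
    apply: contrapT => nx; apply: ny; exists y => // x xxs.
    by rewrite leNgt; apply/negP => xy; apply: nx; exists x.
  case: dxs => uxs dxs; exists (y :: xs); split; last by rewrite /= sxs.
  - split.
      rewrite /= uxs andbT; apply/negP => /yfar; rewrite mdistxx; lra.
    move=> x z; rewrite !inE => /predU1P[->|xx] /predU1P[->|zz]; rewrite ?eqxx //.
    + by move=> _; rewrite metric_sym; exact: yfar.
    + by move=> _; exact: yfar.
    + exact: dxs.
  - by move=> x; rewrite inE => /predU1P[->|/xsW].
have c0 : 0 < c1 * (e / 4) `^ s by rewrite mulr_gt0 // powR_gt0 // divr_gt0.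
(* With N + 1 points the disjoint balls would carry mass greater than 1. *)
pose N := Num.truncn (c1 * (e / 4) `^ s)^-1.
have [xs [dxs _ sxs]] := grow N.+1.
have := @dispersed_size e xs setT e0 er dxs (fun _ _ => @subsetT _ _).
rewrite sxs; apply/negP; rewrite -ltNge HX /=.
rewrite -ltr_pdivrMr // div1r.
by rewrite truncnS_gt // invr_ge0 ltW.
Qed.

Lemma net_size (e : R) (xs : seq X) (W : set X) : 0 < e -> e < r0 ->
  (forall y, W y -> exists2 x, x \in xs & mdist x y < e) ->
  m W <= (size xs)%:R * (c2 * e `^ s).
Proof.
move=> e0 er Wx.
have -> : (size xs)%:R * (c2 * e `^ s) = \sum_(x <- xs) (c2 * e `^ s).
  by rewrite big_const_seq count_predT iter_addr_0 mulr_natl.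
apply: (@le_trans _ _ (\sum_(x <- xs) m (ball x e))).
  apply: fine_hausdorff_cover => y /Wx[x xx xy]; exists x => //.
  by rewrite ballEmdist.
by apply: ler_sum => x _; apply: ahlfors_le; rewrite e0.
Qed.

End packing.

(** * Counting separated points of a set with local scaling *)

Section nets.
Context {R : realType} {X : metricType R}.

(* The local scaling property is used only through these two bounds, which any
   distance preserving map transports, onto or not. *)
Definition upper_nets (a C rmax : R) (A : set X) : Prop :=
  forall f xs (e r : R), A f -> 0 < e <= r -> r < rmax -> dispersed e xs ->
    (forall x, x \in xs -> A x /\ mdist f x < r) ->
    (size xs)%:R * e `^ a <= C * r `^ a.

Definition lower_nets (a c rmax : R) (A : set X) : Prop :=
  forall f (e r : R), A f -> 0 < e <= r -> r < rmax -> exists xs : seq X,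
    [/\ dispersed e xs, forall x, x \in xs -> A x /\ mdist f x < r &
        c * r `^ a <= (size xs)%:R * e `^ a].

Lemma isometry_upper_nets a C rmax A (phi : X -> X) : is_isometry phi ->
  upper_nets a C rmax A -> upper_nets a C rmax (phi @` A).
Proof.
move=> iso hA _ xs e r [f Af <-] er rr [uxs dxs] xsA.
(* [psi] picks preimages in [A] of the listed points, and is arbitrary elsewhere. *)
have /choice[psi psiP] : forall x, exists y, x \in xs -> A y /\ phi y = x.
  move=> x; have [xx|nx] := boolP (x \in xs); last by exists x.
  by have [[y Ay yx] _] := xsA _ xx; exists y.
have dpsi : {in xs &, forall x y, mdist (psi x) (psi y) = mdist x y}.
  by move=> x y xx yy; rewrite -iso (psiP _ xx).2 (psiP _ yy).2.
rewrite -(size_map psi); apply: (hA f) => //.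
  split.
    rewrite map_inj_in_uniq // => x y xx yy xy.
    by rewrite -(psiP _ xx).2 -(psiP _ yy).2 xy.
  move=> _ _ /mapP[x xx ->] /mapP[y yy ->] xy; rewrite dpsi //.
  by apply: dxs => //; apply: contraNneq xy => ->.
move=> _ /mapP[x xx ->]; split; first exact: (psiP _ xx).1.
by rewrite -iso (psiP _ xx).2; exact: (xsA _ xx).2.
Qed.

Lemma isometry_lower_nets a c rmax A (phi : X -> X) : is_isometry phi ->
  lower_nets a c rmax A -> lower_nets a c rmax (phi @` A).
Proof.
move=> iso hA _ e r [f Af <-] er rr.
have inj : injective phi.
  by move=> x y xy; apply: mdist_positivity; rewrite -iso xy mdistxx.
have [xs [[uxs dxs] xsA sxs]] := hA f e r Af er rr.
exists (map phi xs); split; last by rewrite size_map.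
  split; first by rewrite map_inj_uniq.
  move=> _ _ /mapP[x xx ->] /mapP[y yy ->] xy; rewrite iso.
  by apply: dxs => //; apply: contraNneq xy => ->.
move=> _ /mapP[x xx ->]; have [Ax fx] := xsA _ xx.
by split; [exists x|rewrite iso].
Qed.

Context (s c1 c2 r0 : R).
Local Notation H := (@hausdorff_measure R X s).
Local Notation m := (fun A : set X => fine (H A)).
Context (c1_gt0 : 0 < c1) (c2_gt0 : 0 < c2) (r0_gt0 : 0 < r0)
  (HX : H setT = 1%E)
  (ahlfors : forall (x : X) (r : R), 0 < r < r0 ->
     ((c1 * r `^ s)%:E <= H (ball x r) <= (c2 * r `^ s)%:E)%E).

(** Volumes are compared with cardinalities. For the lower bound, the balls of radius 2e about a
    maximal e-net of F_j in B(f, r) cover the e/4-neighbourhood of F_j in B(f, r/2). For the upper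
    bound, disjoint small balls about e-separated points lie in the e-neighbourhood of F_j in B(f,
    2r). *)
Lemma lsp_nets kappa (F : nat -> set X) : local_scaling_property s kappa F ->
  exists c C rmax : R, [/\ 0 < c, 0 < C, 0 < rmax &
    forall j, lower_nets (s * kappa) c rmax (F j) /\
              upper_nets (s * kappa) C rmax (F j)].
Proof.
case=> c3 [c4 [r1 [c3_gt0 c4_gt0 r1_gt0 lsp]]].
set a := s * kappa; set b := s * (1 - kappa).
have sE : s = a + b by rewrite /a /b; ring.
have powsE x : 0 < x -> x `^ s = x `^ a * x `^ b.
  by move=> x0; rewrite sE powRD // (gt_eqF x0) implybT.
have {}lsp (r delta : R) j x : F j x -> 0 < r < r1 -> 0 <= delta < r ->
    c3 * delta `^ b * r `^ a <= m (ball x r `&` Delta (F j) delta)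
      <= c4 * delta `^ b * r `^ a.
  move=> Fx rr dr; have := lsp r delta j x rr dr Fx.
  by rewrite -!lee_fin fineK // (hausdorff_fin HX).
exists (c3 * 4^-1 `^ b * 2^-1 `^ a / (c2 * 2 `^ s)),
  (c4 * 2 `^ a / (c1 * 4^-1 `^ s)), (Num.min r0 r1 / 2).
have pow0 (x p : R) : 0 < x -> 0 < x `^ p by exact: powR_gt0.
split.
- by rewrite !(mulr_gt0, invr_gt0, pow0).
- by rewrite !(mulr_gt0, invr_gt0, pow0).
- by rewrite divr_gt0 // lt_min r0_gt0.
move=> j; split.
- move=> f e r Ff /andP[e0 er].
  rewrite ltr_pdivlMr // lt_min => /andP[rr0 rr1].
  have r_gt0 : 0 < r by exact: lt_le_trans er.
  have [|xs [dxs xsW netW]] := @exists_net _ _ s c1 c2 r0 c1_gt0 HX ahlfors e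
    (F j `&` [set x | mdist f x < r]) e0; first by lra.
  exists xs; split => //.
  have -> : c3 * 4^-1 `^ b * 2^-1 `^ a / (c2 * 2 `^ s) * r `^ a =
      (c3 * (4^-1 `^ b) * (2^-1 `^ a * r `^ a)) / (c2 * 2 `^ s).
    by rewrite mulrAC; congr (_ / _); ring.
  (* The factor e^b completes e^a to e^s, the order of the volume of a ball of radius e. *)
  rewrite ler_pdivrMr ?mulr_gt0 ?pow0 // -(ler_pM2r (pow0 e b e0)).
  
  apply: (@le_trans _ _ (c3 * (e / 4) `^ b * (r / 2) `^ a)).
    rewrite -!powRM ?invr_ge0 ?(ltW e0) ?(ltW r_gt0) //.
    by rewrite [e / 4]mulrC [r / 2]mulrC !powRM ?invr_ge0 ?(ltW e0) ?(ltW r_gt0) //; lra.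
  have /andP[+ _] : c3 * (e / 4) `^ b * (r / 2) `^ a <= m (ball f (r / 2) `&` Delta (F j) (e / 4)) <= c4 * (e / 4) `^ b * (r / 2) `^ a.
    by apply: lsp => //; lra.
  move=> /le_trans; apply.
  have -> : (size xs)%:R * e `^ a * (c2 * 2 `^ s) * e `^ b =
      (size xs)%:R * (c2 * (2 * e) `^ s).
    by rewrite powRM // ?ltW // (powsE e) //; ring.
  apply: (net_size HX ahlfors); [lra|lra|].
  move=> y [/ballP fy /DeltaP[g Fg yg]].
  have [|x xx xg] := netW g.
    split => //=; have := metric_triangle f y g; lra.
  exists x => //; have := metric_triangle x g y; rewrite (metric_sym g y); lra.
- move=> f xs e r Ff /andP[e0 er].
  rewrite ltr_pdivlMr // lt_min => /andP[rr0 rr1] dxs xsF.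
  have r_gt0 : 0 < r by exact: lt_le_trans er.
  rewrite mulrAC ler_pdivlMr ?mulr_gt0 ?pow0 // -(ler_pM2r (pow0 e b e0)).
  have -> : (size xs)%:R * e `^ a * (c1 * 4^-1 `^ s) * e `^ b =
      (size xs)%:R * (c1 * (e / 4) `^ s).
    by rewrite powRM ?invr_ge0 ?(ltW e0) // (powsE e) //; ring.
  apply: (@le_trans _ _ (m (ball f (2 * r) `&` Delta (F j) e))).
    apply: (dispersed_size HX ahlfors) => //; first lra.
    move=> x /xsF[Fx fx] y /ballP xy; split.
      by apply/ballP; have := metric_triangle f x y; lra.
    by apply/DeltaP; exists x => //; rewrite metric_sym; lra.
  have /andP[_ +] : c3 * e `^ b * (2 * r) `^ a <= m (ball f (2 * r) `&` Delta (F j) e) <= c4 * e `^ b * (2 * r) `^ a.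
    by apply: lsp => //; lra.
  move=> /le_trans; apply.
  by rewrite powRM ?(ltW r_gt0) // ; lra.
Qed.

End nets.

(** * Random sets *)

Section finite_vitali.
Context {R : realType} {X : metricType R} (I : eqType) (p : I -> X) (rho : I -> R).

Lemma finite_vitali (u : seq I) : (forall i, i \in u -> 0 < rho i) ->
  exists v : seq I, [/\ uniq v, {subset v <= u},
    forall i j x, i \in v -> j \in v -> mdist (p i) x < rho i ->
      mdist (p j) x < rho j -> i = j &
    forall i, i \in u -> exists2 j, j \in v & rho i <= rho j /\
      exists2 x, mdist (p i) x < rho i & mdist (p j) x < rho j].
Proof.
have [k] := ubnP (size u); elim: k u => // k ih u uk rho0.
have [u0|] := eqVneq u [::]; first by exists [::]; rewrite u0.
case: u uk rho0 => // i0 u0; set u := i0 :: u0 => uk rho0 _.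
have [i iu imax] : exists2 i, i \in u & forall j, j \in u -> rho j <= rho i.
  rewrite /u; elim: u0 i0 {u uk rho0} => [|j u ihu] i.
    by exists i; rewrite ?inE // => j; rewrite inE => /eqP ->.
  have [l lu hl] := ihu j; have [il|li] := leP (rho i) (rho l).
    exists l; first by rewrite inE lu orbT.
    by move=> l'; rewrite inE => /predU1P[->//|/hl].
  exists i; first by rewrite inE eqxx.
  move=> l'; rewrite inE => /predU1P[->//|/hl h]; exact: le_trans h (ltW li).
pose meets j := `[< exists2 x, mdist (p j) x < rho j & mdist (p i) x < rho i >].
have meets_ii : meets i by apply/asboolP; exists (p i); rewrite mdistxx rho0.
have [||v [uv vu dv cv]] := ih [seq j <- u | ~~ meets j].
- rewrite -ltnS; apply: leq_trans uk; rewrite ltnS size_filter.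
  rewrite -(count_predC meets u) -[X in (X < _)%N]add0n ltn_add2r.
  by rewrite -has_count; apply/hasP; exists i.
- by move=> j; rewrite mem_filter => /andP[_]; exact: rho0.
have vi j x : j \in v -> mdist (p j) x < rho j -> mdist (p i) x < rho i -> False.
  move=> /vu; rewrite mem_filter => /andP[/asboolPn + _] jx ix; apply.
  by exists x.
exists (i :: v); split.
- rewrite /= uv andbT; apply/negP => iv.
  by apply: (vi i (p i)) => //; rewrite mdistxx rho0.
- by move=> j; rewrite inE => /predU1P[->//|/vu]; rewrite mem_filter => /andP[].
- move=> j l x; rewrite !inE => /predU1P[->|jv] /predU1P[->|lv] //.
  + by move=> ix lx; case: (vi l x).
  + by move=> jx ix; case: (vi j x).
  + exact: dv.
- move=> j ju; have [/asboolP mj|nmj] := boolP (meets j).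
    by exists i; [rewrite inE eqxx|split => //; exact: imax].
  have [|l lv h] := cv j; first by rewrite mem_filter nmj.
  by exists l => //; rewrite inE lv orbT.
Qed.

End finite_vitali.

(** * Expected counts, independence and exceptional sets *)

Section probability_lemmas.
Context {R : realType} {d : measure_display} {Omega : measurableType d}
  (P : probability Omega R).

Lemma measurable_sum_indic (I : eqType) (u : seq I) (E : I -> set Omega) :
  (forall i, i \in u -> measurable (E i)) ->
  measurable_fun setT (fun w => \sum_(i <- u) \1_(E i) w : R).
Proof.
move=> mE; rewrite (_ : (fun w => _) = (fun w => \sum_(j <- u)
    (if j \in u then \1_(E j) w else 0))).
  apply: measurable_sum => j; have [ju|_] := boolP (j \in u); last exact: measurable_cst.
  by apply: measurable_indic; exact: mE.
by apply/funext => w; rewrite big_seq [RHS]big_seq; apply: eq_bigr => j ->.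
Qed.

Lemma integral_sum_indic (I : eqType) (u : seq I) (E : I -> set Omega) :
  (forall i, i \in u -> measurable (E i)) ->
  (\int[P]_w (\sum_(i <- u) \1_(E i) w)%:E = (\sum_(i <- u) fine (P (E i)))%:E)%E.
Proof.
elim: u => [|i u ih] mE.
  by under eq_integral do rewrite big_nil; rewrite big_nil integral0.
under eq_integral do rewrite big_cons EFinD.
have mi : measurable (E i) by apply: mE; rewrite inE eqxx.
have mu j : j \in u -> measurable (E j) by move=> ju; apply: mE; rewrite inE ju orbT.
rewrite ge0_integralD //.
- by rewrite integral_indic // setIT ih // big_cons EFinD fineK // fin_num_measure.
- exact/measurable_EFinP/measurable_indic.
- by move=> w _; rewrite lee_fin sumr_ge0.
- exact/measurable_EFinP/measurable_sum_indic.
Qed.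

(** Expectations of both sides of the pointwise bound. Read backwards, it bounds P(G) below by an
    expected number of hits. *)
Lemma sum_prob_le (I : eqType) (u : seq I) (E : I -> set Omega) (G : set Omega) (N : R) :
  0 <= N -> measurable G -> (forall i, i \in u -> measurable (E i)) ->
  (forall w, \sum_(i <- u) \1_(E i) w <= N * \1_G w :> R) ->
  \sum_(i <- u) fine (P (E i)) <= N * fine (P G).
Proof.
move=> N0 mG mE h; rewrite -lee_fin -integral_sum_indic // EFinM fineK ?fin_num_measure //.
rewrite -[in leRHS](setIT G) -integral_indic // -ge0_integralZl_EFin //; last first.
  exact/measurable_EFinP/measurable_indic.
apply: ge0_le_integral => //.
- by move=> w _; rewrite lee_fin sumr_ge0.
- exact/measurable_EFinP/measurable_sum_indic.
- by apply: measurable_funeM; exact/measurable_EFinP/measurable_indic.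
- by move=> w _; rewrite -EFinM lee_fin.
Qed.

Lemma markov_sum (I : eqType) (u : seq I) (E : I -> set Omega) (N : R) :
  0 <= N -> (forall i, i \in u -> measurable (E i)) ->
  exists G : set Omega, [/\ measurable G,
    forall w, ~ G w -> \sum_(i <- u) \1_(E i) w < N :> R &
    N * fine (P G) <= \sum_(i <- u) fine (P (E i))].
Proof.
move=> N0 mE; pose f w : R := \sum_(i <- u) \1_(E i) w.
have mf : measurable_fun setT f by exact: measurable_sum_indic.
pose G := [set w | N <= f w].
have mG : measurable G.
  rewrite (_ : G = setT `&` f @^-1` `[N, +oo[); first by apply: mf => //; exact: measurable_itv.
  by apply/seteqP; split => w; rewrite /G /= in_itv /= andbT; [|case].
exists G; split => //; first by move=> w /negP; rewrite -ltNge.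
rewrite -lee_fin -integral_sum_indic // EFinM fineK ?fin_num_measure //.
rewrite -[in leLHS](setIT G) -integral_indic // -ge0_integralZl_EFin //; last first.
  exact/measurable_EFinP/measurable_indic.
apply: ge0_le_integral => //.
- by move=> w _; rewrite -EFinM lee_fin mulr_ge0.
- by apply: measurable_funeM; exact/measurable_EFinP/measurable_indic.
- exact/measurable_EFinP.
- move=> w _; rewrite -EFinM lee_fin indicE; case: (boolP (w \in G)) => wG.
    by rewrite mulr1; move: wG; rewrite inE.
  by rewrite mulr0 sumr_ge0.
Qed.

(** Induction on the list of complemented events, by P(A \ E_j) = P(A) - P(A n E_j). The last term
    moves j to the other list, which is why [v] is general. *)
Lemma independent_complements (E : nat -> set Omega) : independent_events P E ->
  forall u v : seq nat, uniq (u ++ v) ->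
  fine (P [set w | (forall j, j \in u -> ~ E j w) /\ (forall j, j \in v -> E j w)]) =
  (\prod_(j <- u) (1 - fine (P (E j)))) * \prod_(j <- v) fine (P (E j)).
Proof.
move=> [mE indE]; elim=> [|j u ih] v.
  move=> /= uv; rewrite big_nil mul1r.
  have := indE [fset x in v]%fset.
  have -> : \bigcap_(j in [set` [fset x in v]%fset]) E j =
      [set w | (forall j, j \in [::] -> ~ E j w) /\ (forall j, j \in v -> E j w)].
    apply/seteqP; split => w /=.
      by move=> h; split => // j jv; apply: h; rewrite /= inE.
    by move=> [_ h] j; rewrite /= inE => jv; exact: h.
  move=> ->; rewrite (perm_big v) /=; last first.
    by apply: uniq_perm => // [|x]; [exact: fset_uniq|rewrite inE].
  rewrite (eq_bigr (fun j => (fine (P (E j)))%:E)); last by move=> j _; rewrite fineK // fin_num_measure.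
  by rewrite prodEFin.
move=> /= /andP[juv uuv].
pose A := [set w | (forall j, j \in u -> ~ E j w) /\ (forall j, j \in v -> E j w)].
have mA : measurable A.
  rewrite (_ : A = (\bigcap_(k in [set` u]) ~` E k) `&` (\bigcap_(k in [set` v]) E k)).
    by apply: measurableI; apply: fin_bigcap_measurable => // k _; exact: measurableC.
  by apply/seteqP; split.
have -> : [set w | (forall k, k \in j :: u -> ~ E k w) /\ (forall k, k \in v -> E k w)] =
    A `\` E j.
  apply/seteqP; split => w /=.
    move=> [h1 h2]; split; last by apply: h1; rewrite inE eqxx.
    by split => // k ku; apply: h1; rewrite inE ku orbT.
  move=> [[h1 h2] h3]; split => // k; rewrite inE => /predU1P[->//|]; exact: h1.
rewrite measureD //; last by rewrite ltey_eq fin_num_measure.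
rewrite fineB ?fin_num_measure //; last exact: measurableI.
rewrite ih // (_ : A `&` E j = [set w | (forall k, k \in u -> ~ E k w) /\
    (forall k, k \in j :: v -> E k w)]).
  rewrite ih; last by rewrite -[j :: v]cat1s uniq_catCA /= juv.
  by rewrite !big_cons; ring.
apply/seteqP; split => w /=.
  move=> [[h1 h2] h3]; split => // k; rewrite inE => /predU1P[->//|]; exact: h2.
move=> [h1 h2]; split; last by apply: h2; rewrite inE eqxx.
by split => // k kv; apply: h2; rewrite inE kv orbT.
Qed.

(** [Q] may fail to be measurable: the intersection of the exceptional sets for e = 1/(k+1) is a
    measurable null set containing every failure. *)
Lemma ae_of_small_exceptions (Q : Omega -> Prop) :
  (forall e : R, 0 < e -> exists G : set Omega,
     [/\ measurable G, (P G <= e%:E)%E & forall w, ~ G w -> Q w]) ->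
  {ae P, forall w, Q w}.
Proof.
move=> h.
have /choice[G GP] : forall k : nat, exists G : set Omega,
    [/\ measurable G, (P G <= (k.+1%:R^-1)%:E)%E & forall w, ~ G w -> Q w].
  by move=> k; apply: h; rewrite invr_gt0.
exists (\bigcap_k G k); split.
- by apply: bigcapT_measurable => k; case: (GP k).
- apply/eqP; rewrite eq_le measure_ge0 andbT; apply/lee_addgt0Pr => e e0.
  rewrite add0e.
  have [k ke] : exists k : nat, k.+1%:R^-1 <= e.
    near \oo => k; exists k; apply: ltW; near: k; exact: near_infty_natSinv_lt (PosNum e0).
  have [mG Gk _] := GP k; apply: (@le_trans _ _ (P (G k))); last first.
    by apply: le_trans Gk _; rewrite lee_fin.
  apply: le_measure; rewrite ?inE //; last exact: bigcap_inf.
  by apply: bigcapT_measurable => l; case: (GP l).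
- by move=> w /= nQ k _; apply: contrapT => nG; apply: nQ; case: (GP k) => _ _; apply.
Unshelve. all: by end_near. Qed.

End probability_lemmas.

(** * Products that vanish by divergence of the harmonic series *)

Section harmonic_product.
Context {R : realType}.

Lemma harmonic_unbounded (n : nat) (M : R) :
  exists N, M <= \sum_(n <= j < n + N) j.+1%:R^-1.
Proof.
apply: contrapT => h; apply: (@dvg_harmonic R).
apply: nondecreasing_is_cvgn.
  by apply: nondecreasing_series => j _ _; exact: harmonic_ge0.
exists (\sum_(0 <= j < n) harmonic j + `|M|) => _ [k _ <-].
rewrite /series /=.
have [kn|nk] := leqP k n.
  rewrite (big_cat_nat (leq0n k) kn) //= -addrA lerDl addr_ge0 //.
  by rewrite sumr_ge0 // => j _; exact: harmonic_ge0.
rewrite (big_cat_nat (leq0n n) (ltnW nk)) //= lerD2l leNgt; apply/negP => Mk.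
apply: h; exists (k - n)%N; rewrite subnKC ?(ltnW nk) //.
by apply: le_trans (ltW Mk); exact: ler_norm.
Qed.

(** The product times 1 + c (sum of 1/(j+1)) never exceeds 1, because (1 - u)(1 + v + u) <= 1 + v
    for u, v >= 0. The sum diverges, so the product tends to 0. *)
Lemma prod_harmonic_small (c e : R) (n : nat) : 0 < c -> c <= 1 -> 0 < e ->
  exists N, \prod_(n <= j < n + N) (1 - c / j.+1%:R) <= e.
Proof.
move=> c0 c1 e0.
have pos j : 0 <= 1 - c / j.+1%:R.
  by rewrite subr_ge0 ler_pdivrMr // mul1r (le_trans c1) // ler1n.
have bound N : \prod_(n <= j < n + N) (1 - c / j.+1%:R) *
    (1 + c * \sum_(n <= j < n + N) j.+1%:R^-1) <= 1.
  elim: N => [|N ih]; first by rewrite addn0 !big_geq // mulr0 addr0 mulr1.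
  rewrite addnS !big_nat_recr ?leq_addr //=; apply: le_trans ih.
  set p := \prod_(_ <= _ < _) _; set S := \sum_(_ <= _ < _) _.
  have p0 : 0 <= p by rewrite /p; apply: prodr_ge0 => j _; exact: pos.
  have S0 : 0 <= S by rewrite /S sumr_ge0.
  rewrite -mulrA ler_wpM2l //; pose x : R := (n + N).+1%:R^-1; rewrite -/x.
  have x0 : 0 <= c * x by rewrite mulr_ge0 ?ltW // /x invr_gt0 ltr0n.
  have S1 : 0 <= c * S by rewrite mulr_ge0 // ltW.
  by rewrite mulrDr; nra.
have [N hN] := harmonic_unbounded n (e^-1 / c).
exists N; have := bound N; set p := \prod_(_ <= _ < _) _ => h.
have p0 : 0 <= p by rewrite /p; apply: prodr_ge0 => j _; exact: pos.
rewrite -[leRHS]invrK -div1r ler_pdivlMr ?invr_gt0 //.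
apply: le_trans h; rewrite ler_wpM2l //.
move: hN; rewrite ler_pdivrMr // mulrC => hN; lra.
Qed.

End harmonic_product.

(** * A lower bound for the probability of being close to a random set *)

Section hitting_probability.
Context {R : realType} {X : metricType R}.
Context {d : measure_display} {Omega : measurableType d} (P : probability Omega R).
Context (s c1 c2 r0 a b : R).
Local Notation H := (@hausdorff_measure R X s).
Local Notation m := (fun A : set X => fine (H A)).
Context (c1_gt0 : 0 < c1) (c2_gt0 : 0 < c2) (r0_gt0 : 0 < r0) (sE : s = a + b)
  (HX : H setT = 1%E)
  (ahlfors : forall (x : X) (r : R), 0 < r < r0 ->
     ((c1 * r `^ s)%:E <= H (ball x r) <= (c2 * r `^ s)%:E)%E).

Lemma open_metric_ball (x : X) (r : R) : open (ball x r).
Proof.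
rewrite openE => y /ballP xy; rewrite /interior /= -nbhs_ballE.
exists (r - mdist x y); first by rewrite /= subr_gt0.
move=> z /ballP yz; apply/ballP; have := metric_triangle x y z; lra.
Qed.

(** As [B] is open, its points in the closure of [Y] are approximated by points of [Y] still in [B];
    an e-net of the latter is a 2e-net of the former. *)
Lemma closure_net_size (Y B : set X) (e : R) (xs : seq X) : open B ->
  0 < e -> 2 * e < r0 ->
  (forall y, (Y `&` B) y -> exists2 x, x \in xs & mdist x y < e) ->
  m (B `&` closure Y) <= (size xs)%:R * (c2 * (2 * e) `^ s).
Proof.
move=> oB e0 er net; apply: (net_size HX ahlfors) => //; first lra.
move=> y [By clY].
have [v [Yv [Bv /ballP yv]]] : (Y `&` (B `&` ball y e)) !=set0.
  apply: clY; apply: filterI; first exact: open_nbhs_nbhs.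
  exact: nbhsx_ballx.
have [x xx xv] := net v (conj Yv Bv); exists x => //.
have := metric_triangle x v y; rewrite (metric_sym v y); lra.
Qed.

(* The law is known only below a threshold that depends on the point and the set.
   At a scale d' below most thresholds, the expected number of hits among the
   points of a d'-net of B(x, delta / 2) is known, and the number of hits is at most
   of order (delta / d')^a and is 0 unless x is delta-close to A. *)
Lemma hitting_probability_ge (C c' rm : R) : 0 < C -> 0 < c' -> 0 < rm ->
  exists c rmax : R, [/\ 0 < c, 0 < rmax & forall A : Omega -> set X,
    (forall w, upper_nets a C rm (A w)) ->
    (forall x, \forall delta \near 0^'+, measurable [set w | Delta (A w) delta x] /\
       c' * delta `^ b <= fine (P [set w | Delta (A w) delta x])) ->
    forall (x : X) (delta : R), 0 < delta < rmax -> measurable [set w | Delta (A w) delta x] ->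
      c * delta `^ b <= fine (P [set w | Delta (A w) delta x])].
Proof.
move=> C0 c'0 rm0.
have pow0 (x p : R) : 0 < x -> 0 < x `^ p by exact: powR_gt0.
exists (c1 / 2 * 2^-1 `^ s * c' / (c2 * 8 `^ s * C)), (Num.min r0 (rm / 2)).
split.
- by rewrite !(mulr_gt0, invr_gt0, pow0).
- by rewrite lt_min r0_gt0 divr_gt0.
move=> A netA hA x delta; rewrite lt_min => /andP[d0 /andP[dr0 drm]] mE.
set E := [set w | Delta (A w) delta x] in mE *.
pose good y delta' := measurable [set w | Delta (A w) delta' y] /\
  c' * delta' `^ b <= fine (P [set w | Delta (A w) delta' y]).
(* These sets increase to the whole space, so the closure of one of them carries a definite part of
   the measure of [B]. *)
pose Y (n : nat) := [set y | forall delta' : R, 0 < delta' < n.+1%:R^-1 -> good y delta'].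
pose B := ball x (delta / 2).
have c1half : c1 / 2 < c1 by have c1p := c1_gt0; lra.
have [|||n hn] := @hausdorff_measure_closure_cover R X s Y B (c1 / 2 * (delta / 2) `^ s)%:E.
- move=> k l kl y hy delta' /andP[d'0 d'l]; apply: hy; rewrite d'0 /=.
  by apply: lt_le_trans d'l _; rewrite lef_pV2 ?posrE ?ltr0n // ler_nat.
- apply/seteqP; split => // y _; have [e /= e0 he] := hA y.
  have [n ne] : exists n : nat, n.+1%:R^-1 < e.
    by near \oo => n; exists n; near: n; exact: near_infty_natSinv_lt (PosNum e0).
  exists n => // delta' /andP[d'0 d'n]; apply: he => //=.
  by rewrite sub0r normrN gtr0_norm // (lt_trans d'n).
- have /andP[+ _] : ((c1 * (delta / 2) `^ s)%:E <= H B <= (c2 * (delta / 2) `^ s)%:E)%E.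
    by apply: ahlfors; lra.
  apply: lt_le_trans; rewrite lte_fin ltr_pM2r; [exact: c1half|by apply: pow0; lra].
(* The index n + 2 keeps [d'] strictly below the threshold 1/(n+1). *)
pose d' := Num.min (delta / 8) n.+2%:R^-1.
have d'0 : 0 < d' by rewrite lt_min divr_gt0 // invr_gt0 ltr0n.
have d'd : d' <= delta / 8 by rewrite ge_min lexx.
have d'n : d' < n.+1%:R^-1.
  by rewrite gt_min orbC ltf_pV2 ?posrE ?ltr0n // ltr_nat ltnSn.
have [||xs [dxs xsW netW]] := @exists_net _ _ s c1 c2 r0 c1_gt0 HX ahlfors (4 * d')
    (Y n `&` B).
- lra.
- lra.
have hY y : y \in xs -> good y d'.
  by move=> /xsW[Yy _]; apply: Yy; rewrite d'0.
have I1 : c1 / 2 * (delta / 2) `^ s <= (size xs)%:R * (c2 * (8 * d') `^ s).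
  rewrite (_ : 8 * d' = 2 * (4 * d')); last by ring.
  apply: le_trans (closure_net_size _ _ _ netW); [|exact: open_metric_ball|lra|lra].
  by rewrite -lee_fin fineK ?(hausdorff_fin HX) // ltW.
have Ey y : y \in xs -> measurable [set w | Delta (A w) d' y] by case/hY.
have I2 : \sum_(y <- xs) fine (P [set w | Delta (A w) d' y]) <=
    (C * (2 * delta) `^ a / (2 * d') `^ a) * fine (P E).
  apply: sum_prob_le => //.
    by rewrite ltW // !(mulr_gt0, invr_gt0, pow0).
  move=> w.
  have -> : \sum_(y <- xs) \1_[set w0 | Delta (A w0) d' y] w =
      (size [seq y <- xs | `[< Delta (A w) d' y >]])%:R :> R.
    rewrite size_filter -sum1_count natr_sum [RHS]big_mkcond /=.
    by apply: eq_bigr => y _; rewrite indicE; case: asboolP => h; [rewrite mem_set|rewrite memNset].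
  set ys := [seq _ <- _ | _].
  have [->|[y0 y0s]] : ys = [::] \/ exists y, y \in ys.
  - by case: ys => [|y l]; [left|right; exists y; rewrite inE eqxx].
  - by rewrite /= mulr_ge0 // ltW // !(mulr_gt0, invr_gt0, pow0).
  (* Each net point that is hit has a point [g y] of the random set within [d']. As the net is
     4d'-separated, these are 2d'-separated; they lie in one ball of radius 2 delta centred on the
     set, so [upper_nets] limits their number. *)
  have /choice[g gP] : forall y, exists z, y \in ys -> A w z /\ mdist y z < d'.
    move=> y; have [|_] := boolP (y \in ys); last by exists y.
    by rewrite mem_filter => /andP[/asboolP/DeltaP[z Az yz] _]; exists z.
  have ysW y : y \in ys -> mdist x y < delta / 2.
    by rewrite mem_filter => /andP[_ /xsW[_ /ballP]].
  have ysd y z : y \in ys -> z \in ys -> y != z -> 4 * d' <= mdist y z.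
    by rewrite !mem_filter => /andP[_ yx] /andP[_ zx]; apply: dxs.2.
  have gsep y z : y \in ys -> z \in ys -> y != z -> 2 * d' <= mdist (g y) (g z).
    move=> yy zz yz; have := ysd _ _ yy zz yz.
    have [_ gy] := gP _ yy; have [_ gz] := gP _ zz.
    have := metric_triangle y (g y) z; have := metric_triangle (g y) (g z) z.
    rewrite (metric_sym (g z) z); lra.
  have wE : E w.
    apply/DeltaP; exists (g y0); first exact: (gP _ y0s).1.
    have := (gP _ y0s).2; have := ysW _ y0s; have := metric_triangle x y0 (g y0); lra.
  rewrite indicE mem_set // mulr1 ler_pdivlMr ?pow0 ?mulr_gt0 // -(size_map g).
  apply: (netA w (g y0)); first exact: (gP _ y0s).1.
  - lra.
  - lra.
  - split.
      rewrite map_inj_in_uniq ?filter_uniq ?dxs.1 // => y z yy zz gyz.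
      apply/eqP; apply: contraT => /(gsep _ _ yy zz).
      by rewrite gyz mdistxx; lra.
    move=> _ _ /mapP[y yy ->] /mapP[z zz ->] gyz; apply: gsep => //.
    by apply: contraNneq gyz => ->.
  - move=> _ /mapP[y yy ->]; split; first exact: (gP _ yy).1.
    have := (gP _ y0s).2; have := (gP _ yy).2; have := ysW _ yy; have := ysW _ y0s.
    have := metric_triangle (g y0) y0 (g y); have := metric_triangle y0 y (g y).
    have := metric_triangle y0 x y.
    rewrite (metric_sym (g y0) y0) (metric_sym y0 x); lra.
have I3 : (size xs)%:R * (c' * d' `^ b) <=
    (C * (2 * delta) `^ a / (2 * d') `^ a) * fine (P E).
  apply: le_trans I2.
  rewrite (_ : (size xs)%:R * _ = \sum_(y <- xs) (c' * d' `^ b)).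
    by rewrite big_seq [leRHS]big_seq; apply: ler_sum => y /hY[].
  by rewrite big_const_seq count_predT iter_addr_0 mulr_natl.
(* The auxiliary scale drops out: K d'^s is at least of order delta^s by [I1] and at most of order
   delta^a p by [I3], and s = a + b. *)
move: I1 I3; move: (size xs)%:R (fine (P E)) => K p I1 I3.
have powsE u : 0 < u -> u `^ s = u `^ a * u `^ b.
  by move=> u0; rewrite sE powRD // (gt_eqF u0) implybT.
have p2a := pow0 2 a (ltr0n _ 2).
have pda := pow0 _ a d0; have pd'a := pow0 _ a d'0; have pd'b := pow0 _ b d'0.
have {}I3 : K * (c' * d' `^ s) <= C * delta `^ a * p.
  move: I3; rewrite !powRM ?(ltW d0) ?(ltW d'0) //.
  rewrite -(ler_pM2r pd'a) (powsE d') // => I3; rewrite mulrA [X in _ * X]mulrC !mulrA.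
  rewrite -!mulrA in I3 *; apply: le_trans I3 _; rewrite le_eqVlt; apply/orP; left; apply/eqP.
  by field; rewrite ?gt_eqF.
move: I1; rewrite !powRM ?(ltW d0) ?(ltW d'0) ?invr_ge0 // => I1.
rewrite mulrAC ler_pdivrMr ?mulr_gt0 ?pow0 // -(ler_pM2l pda).
have p8 := pow0 8 s (ltr0n _ 8).
apply: (@le_trans _ _ (K * (c' * d' `^ s) * (c2 * 8 `^ s))); last first.
  apply: le_trans (ler_wpM2r _ I3) _; first by rewrite ltW // mulr_gt0.
  by rewrite le_eqVlt; apply/orP; left; apply/eqP; ring.
apply: le_trans (_ : c1 / 2 * (delta `^ s * 2^-1 `^ s) * c' <= _).
  by rewrite (powsE delta) // le_eqVlt; apply/orP; left; apply/eqP; ring.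
apply: le_trans (ler_wpM2r (ltW c'0) I1) _.
by rewrite le_eqVlt; apply/orP; left; apply/eqP; ring.
Unshelve. all: by end_near. Qed.

End hitting_probability.

(** * Decay of negative powers *)

Section natural_powers.
Context {R : realType}.

Lemma natS_powRN_small (p e : R) : 0 < p -> 0 < e ->
  exists N : nat, forall j : nat, (N <= j)%N -> j.+1%:R `^ (- p) < e.
Proof.
move=> p0 e0; exists (Num.truncn (e^-1 `^ p^-1)) => j Nj.
have h : e^-1 `^ p^-1 < j.+1%:R.
  by apply: lt_le_trans (truncnS_gt _) _; rewrite ler_nat ltnS.
rewrite powRN invf_plt ?posrE ?powR_gt0 //.
rewrite -[e^-1](_ : (e^-1 `^ p^-1) `^ p = _); last first.
  by rewrite -powRrM mulVf ?gt_eqF // powRr1 // invr_ge0 ltW.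
by rewrite gt0_ltr_powR // nnegrE ?powR_ge0 ?ler0n.
Qed.

Lemma natS_powRN_le (p : R) (i j : nat) : 0 <= p -> (i <= j)%N ->
  j.+1%:R `^ (- p) <= i.+1%:R `^ (- p).
Proof.
move=> p0 ij; rewrite !powRN lef_pV2 ?posrE ?powR_gt0 //.
by rewrite ge0_ler_powR // ?nnegrE ?ler0n // ler_nat.
Qed.

End natural_powers.

(** * Disjoint families of balls of critical radius *)

Section disjoint_families.
Context {R : realType} {X : metricType R}.
Context {d : measure_display} {Omega : measurableType d} (P : probability Omega R).
Context (s c1 c2 r0 b : R).
Local Notation H := (@hausdorff_measure R X s).
Local Notation m := (fun A : set X => fine (H A)).
Context (c1_gt0 : 0 < c1) (c2_gt0 : 0 < c2) (r0_gt0 : 0 < r0) (b_gt0 : 0 < b)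
  (HX : H setT = 1%E)
  (ahlfors : forall (x : X) (r : R), 0 < r < r0 ->
     ((c1 * r `^ s)%:E <= H (ball x r) <= (c2 * r `^ s)%:E)%E).

(* The radius at which the hitting probabilities are of order 1/(j + 1), so that
   their sum only just diverges. *)
Definition critical_radius (b : R) (j : nat) : R := j.+1%:R `^ (- b^-1).

(** A pair (z, j) stands for the ball about z of critical radius; the index also records the set
    that z belongs to. *)
Definition ball_family (A : nat -> set X) (W : set X) (n : nat)
    (u : seq (X * nat)) : Prop :=
  [/\ uniq u,
    forall p, p \in u -> [/\ (n <= p.2)%N, A p.2 p.1 & W p.1] &
    forall p q z, p \in u -> q \in u -> mdist p.1 z < critical_radius b p.2 ->
      mdist q.1 z < critical_radius b q.2 -> p = q].

Lemma critical_radius_gt0 j : 0 < critical_radius b j.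
Proof. exact: powR_gt0. Qed.

Lemma critical_radius_pow j : critical_radius b j `^ b = j.+1%:R^-1.
Proof. by rewrite /critical_radius -powRrM mulNr mulVf ?gt_eqF // powR_inv1. Qed.

(* Take a net at the smallest scale involved. By Markov's inequality at most half of
   its points are missed; Vitali's lemma applies to the balls hitting the others. *)
Lemma ball_family_likely (A : Omega -> nat -> set X) (ch rh : R) :
  0 < ch -> 0 < rh ->
  (forall j (x : X) (delta : R), 0 < delta < rh ->
     measurable [set w | Delta (A w j) delta x] ->
     ch * delta `^ b <= fine (P [set w | Delta (A w j) delta x])) ->
  (forall x : X, exists2 delta0 : R, 0 < delta0 &
     forall delta : nat -> R, (forall j, 0 < delta j < delta0) ->
     independent_events P (fun j => [set w | Delta (A w j) (delta j) x])) ->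
  exists2 k0 : R, 0 < k0 & forall (x : X) (r : R) (n : nat) (e : R),
    0 < r < r0 -> 0 < e -> exists G : set Omega,
    [/\ measurable G, (P G <= e%:E)%E & forall w, ~ G w ->
      exists u, ball_family (A w) (ball x (2 * r)) n u /\
        k0 * r `^ s <= \sum_(p <- u) critical_radius b p.2 `^ s].
Proof.
move=> ch0 rh0 hit ind.
have pow0 (x p : R) : 0 < x -> 0 < x `^ p by exact: powR_gt0.
pose c := Num.min ch 1.
have c0 : 0 < c by rewrite lt_min ch0 ltr01.
have c_le1 : c <= 1 by rewrite ge_min lexx orbT.
have cch : c <= ch by rewrite ge_min lexx.
exists (c1 / 2 * (2^-1 * c1 * 4^-1 `^ s) / (c2 * 2 `^ s * (c2 * 4 `^ s))).
  by rewrite !(mulr_gt0, invr_gt0, pow0).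
move=> x r n e /andP[r_gt0 rr0] e0.
pose indep y (eta : R) := forall delta : nat -> R, (forall j, 0 < delta j < eta) ->
     independent_events P (fun j => [set w | Delta (A w j) (delta j) y]).
(* The threshold for independence depends on the point; as before, one bound 1/(q+1) works on a set
   whose closure carries enough of the ball. *)
pose Y (q : nat) := [set y | indep y q.+1%:R^-1].
pose B := ball x r.
have c1half : c1 / 2 < c1 by have c1p := c1_gt0; lra.
have [|||q hq] := @hausdorff_measure_closure_cover R X s Y B (c1 / 2 * r `^ s)%:E.
- move=> k l kl y hy delta dl; apply: hy => j; have /andP[-> /=] := dl j.
  by move=> /lt_le_trans; apply; rewrite lef_pV2 ?posrE ?ltr0n // ler_nat.
- apply/seteqP; split => // y _; have [e1 e10 he] := ind y.
  have [k ke] : exists k : nat, k.+1%:R^-1 < e1.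
    by near \oo => k; exists k; near: k; exact: near_infty_natSinv_lt (PosNum e10).
  exists k => // delta dk; apply: he => j; have /andP[-> /=] := dk j.
  by move=> /lt_trans; apply.
- have /andP[+ _] : ((c1 * r `^ s)%:E <= H B <= (c2 * r `^ s)%:E)%E.
    by apply: ahlfors; rewrite r_gt0.
  by apply: lt_le_trans; rewrite lte_fin ltr_pM2r //; exact: pow0.
pose small := Num.min (Num.min rh q.+1%:R^-1) (Num.min r (r0 / 8)).
have small0 : 0 < small by rewrite !lt_min rh0 r_gt0 divr_gt0 ?invr_gt0 ?ltr0n.
have [n0 n0P] := @natS_powRN_small R b^-1 small (ltac:(by rewrite invr_gt0)) small0.
pose n1 := maxn n n0.
have radius_small j : (n1 <= j)%N ->
    [/\ critical_radius b j < rh, critical_radius b j < q.+1%:R^-1, critical_radius b j < r & 8 * critical_radius b j < r0].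
  move=> n1j; have : critical_radius b j < small by apply: n0P; apply: leq_trans n1j; exact: leq_maxr.
  by rewrite !lt_min => /andP[/andP[-> ->] /andP[-> h]]; split => //; lra.
have [N thetaP] := @prod_harmonic_small R c (e / 2) n1 c0 c_le1 (ltac:(by rewrite divr_gt0)).
pose J := index_iota n1 (n1 + N).
(* Independence is given for whole sequences below the threshold, so the indices before [n1] receive
   a harmless value. *)
pose delta j : R := if (n1 <= j)%N then critical_radius b j else q.+1%:R^-1 / 2.
have deltaP j : 0 < delta j < q.+1%:R^-1.
  have q0 : 0 < q.+1%:R^-1 :> R by rewrite invr_gt0 ltr0n.
  rewrite /delta; case: ifPn => [/radius_small[_ -> _ _]|_].
    by rewrite critical_radius_gt0.
  by move: (q.+1%:R^-1 : R) q0 => v v0; apply/andP; split; lra.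
pose en := critical_radius b (n1 + N).
have en0 : 0 < en by exact: critical_radius_gt0.
have [_ _ _ enr0] := radius_small _ (leq_addr N n1); rewrite -/en in enr0.
have enJ j : j \in J -> en <= critical_radius b j.
  rewrite mem_index_iota => /andP[_ /ltnW]; apply: natS_powRN_le.
  by rewrite invr_ge0 ltW.
have [||xs [dxs xsW netW]] := @exists_net _ _ s c1 c2 r0 c1_gt0 HX ahlfors en
    (Y q `&` B).
- exact: en0.
- lra.
have I1 : c1 / 2 * r `^ s <= (size xs)%:R * (c2 * (2 * en) `^ s).
  apply: le_trans (closure_net_size HX ahlfors _ _ _ netW); [|exact: open_metric_ball|lra|lra].
  by rewrite -lee_fin fineK ?(hausdorff_fin HX) // ltW.
pose E y j := [set w | Delta (A w j) (delta j) y].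
have indE y : y \in xs -> independent_events P (E y).
  by move=> /xsW[Yy _]; exact: Yy.
pose Bad y := [set w | (forall j, j \in J -> ~ E y j w) /\ (forall j, j \in [::] -> E y j w)].
have uJ : uniq (J ++ [::]) by rewrite cats0 iota_uniq.
have mBad y : y \in xs -> measurable (Bad y).
  move=> /indE[mE _]; rewrite (_ : Bad y = \bigcap_(k in [set` J]) ~` E y k).
    by apply: fin_bigcap_measurable => // k _; exact: measurableC.
  by apply/seteqP; split => w /= => [[]|].
(* By independence, missing [y] at all indices of [J] has probability at most the product of 1 -
   c/(j+1), as the b-th power of the critical radius is 1/(j+1). *)
have PBad y : y \in xs -> fine (P (Bad y)) <= e / 2.
  move=> yxs; rewrite (independent_complements (indE _ yxs)) // big_nil mulr1.
  apply: le_trans thetaP; rewrite big_seq [leRHS]big_seq; apply: ler_prod => j jJ.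
  have [mE _] := indE _ yxs.
  rewrite subr_ge0 -lee_fin fineK ?fin_num_measure // probability_le1 //=.
  rewrite lerD2l lerN2 -critical_radius_pow.
  have n1j : (n1 <= j)%N by move: jJ; rewrite mem_index_iota => /andP[].
  have dE : delta j = critical_radius b j by rewrite /delta n1j.
  have [jrh _ _ _] := radius_small _ n1j.
  apply: le_trans (ler_wpM2r (powR_ge0 _ _) cch) _.
  by rewrite -dE; apply: hit; [rewrite dE critical_radius_gt0|exact: mE].
set K : R := (size xs)%:R in I1.
have K0 : 0 < K.
  have h : 0 < K * (c2 * (2 * en) `^ s).
    by apply: lt_le_trans I1; rewrite !mulr_gt0 ?pow0 ?invr_gt0.
  by move: h; rewrite pmulr_lgt0 // mulr_gt0 // pow0 // mulr_gt0.
(* The expected number of missed points is at most K e / 2, so K / 2 of them are missed with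
   probability at most [e]. *)
have [G [mG GP GK]] := @markov_sum _ _ _ P _ xs Bad (K / 2) (ltac:(lra)) mBad.
exists G; split => //.
  rewrite -(fineK (fin_num_measure P _ mG)) lee_fin.
  have : K / 2 * fine (P G) <= K * (e / 2).
    apply: le_trans GK _; apply: (@le_trans _ _ (\sum_(y <- xs) (e / 2))).
      by rewrite big_seq [leRHS]big_seq; apply: ler_sum => y /PBad.
    by rewrite big_const_seq count_predT iter_addr_0 mulr_natl.
  by move=> h; rewrite -(ler_pM2l K0); lra.
move=> w /GP sBad.
pose ys := [seq y <- xs | ~~ `[< Bad y w >]].
have sys : K / 2 <= (size ys)%:R.
  have : (\sum_(y <- xs) \1_(Bad y) w) + (size ys)%:R = K :> R.
    rewrite /K /ys size_filter -(count_predC (fun y => `[< Bad y w >]) xs) natrD.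
    congr (_ + _); rewrite -sum1_count natr_sum [RHS]big_mkcond /=.
    by apply: eq_bigr => y _; rewrite indicE; case: asboolP => h; [rewrite mem_set|rewrite memNset].
  by move=> h; lra.
have /choice[g gP] : forall y, exists p : X * nat, y \in ys ->
    [/\ p.2 \in J, A w p.2 p.1 & mdist y p.1 < critical_radius b p.2].
  move=> y; have [|_] := boolP (y \in ys); last by exists (y, 0%N).
  rewrite mem_filter => /andP[/asboolPn nBad _].
  apply: contrapT => /forallNP nex; apply: nBad; split => // j jJ /DeltaP[z Az yz].
  apply: (nex (z, j)) => _; split => //=.
  by move: yz; rewrite /delta; move: jJ; rewrite mem_index_iota => /andP[-> _].
have [|v [uv vu dv cv]] := @finite_vitali R X _ fst (fun p : X * nat => critical_radius b p.2) (map g ys).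
  by move=> p _; exact: critical_radius_gt0.
exists v; split.
  split => //.
  move=> p /vu/mapP[y yys ->]; have [gJ gA yg] := gP _ yys; split => //.
    by move: gJ; rewrite mem_index_iota => /andP[+ _]; apply: leq_trans; exact: leq_maxl.
  apply/ballP; have : mdist x y < r by move: yys; rewrite mem_filter => /andP[_ /xsW[_ /ballP]].
  have [_ _ + _] : [/\ critical_radius b (g y).2 < rh, critical_radius b (g y).2 < q.+1%:R^-1, critical_radius b (g y).2 < r & 8 * critical_radius b (g y).2 < r0].
    by apply: radius_small; move: gJ; rewrite mem_index_iota => /andP[].
  have := metric_triangle x y (g y).1; lra.
have vJ p : p \in v -> p.2 \in J by move=> /vu/mapP[y yys ->]; case: (gP _ yys).
(* A point [y] lies in a hitting ball that meets a selected ball at least as large, so it is within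
   three radii of the selected centre. The points close to one centre are counted by volume in a
   ball of four radii. *)
pose close_to p := [seq y <- ys | mdist p.1 y < 3 * critical_radius b p.2].
have close_toP p : p \in v -> (size (close_to p))%:R * (c1 * (en / 4) `^ s) <= c2 * (4 * critical_radius b p.2) `^ s.
  move=> /vJ pJ; have [_ _ _ pr0] : [/\ critical_radius b p.2 < rh, critical_radius b p.2 < q.+1%:R^-1, critical_radius b p.2 < r & 8 * critical_radius b p.2 < r0].
    by apply: radius_small; move: pJ; rewrite mem_index_iota => /andP[].
  have p0 := critical_radius_gt0 p.2.
  have p4 : 0 < 4 * critical_radius b p.2 < r0 by apply/andP; split; lra.
  apply: le_trans (ahlfors_le HX ahlfors p.1 p4).
  apply: (dispersed_size HX ahlfors) => //; first lra.
    case: dxs => uxs dxs; split; first by rewrite !filter_uniq.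
    move=> y z; rewrite !mem_filter => /andP[_ /andP[_ yxs]] /andP[_ /andP[_ zxs]].
    exact: dxs.
  move=> y; rewrite mem_filter => /andP[py _] z /ballP yz; apply/ballP.
  have := metric_triangle p.1 y z; have := enJ _ pJ; lra.
have sizeys : (size ys <= \sum_(p <- v) size (close_to p))%N.
  rewrite -[size ys]count_predT -sum1_count.
  under [leqRHS]eq_bigr do rewrite size_filter -sum1_count big_mkcond.
  rewrite exchange_big /= big_seq [leqRHS]big_seq; apply: leq_sum => y yys.
  have [gJ gA yg] := gP _ yys.
  have [p pv [rp [z gz pz]]] := cv (g y) (map_f g yys).
  rewrite (big_rem p) //= ifT ?leq_addr //.
  have := metric_triangle p.1 z y; have := metric_triangle z (g y).1 y.
  rewrite (metric_sym z (g y).1) (metric_sym (g y).1 y); lra.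
have I2 : K / 2 * (c1 * (en / 4) `^ s) <= \sum_(p <- v) c2 * (4 * critical_radius b p.2) `^ s.
  apply: (@le_trans _ _ ((\sum_(p <- v) size (close_to p))%:R * (c1 * (en / 4) `^ s))).
    rewrite ler_wpM2r //.
      by rewrite ltW // mulr_gt0 // pow0 // divr_gt0.
    by apply: le_trans sys _; rewrite ler_nat.
  by rewrite natr_sum mulr_suml big_seq [leRHS]big_seq; apply: ler_sum => p /close_toP.
have sumE : \sum_(p <- v) c2 * (4 * critical_radius b p.2) `^ s =
    c2 * 4 `^ s * \sum_(p <- v) critical_radius b p.2 `^ s.
  rewrite mulr_sumr; apply: eq_bigr => p _.
  by rewrite powRM ?(ltW (critical_radius_gt0 _)) // mulrA.
(* The net scale [en] cancels between the lower bound on the number of net points and the upper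
   bound on those near selected balls. *)
move: I1 I2; rewrite sumE !powRM ?(ltW en0) ?invr_ge0 //.
move: (\sum_(p <- v) _) => S I1 I2.
have pe := pow0 _ s en0; have p2 := pow0 2 s (ltr0n _ 2); have p4 := pow0 4 s (ltr0n _ 4).
rewrite mulrAC ler_pdivrMr ?mulr_gt0 // -(ler_pM2r pe).
apply: (@le_trans _ _ ((K * (c2 * (2 `^ s * en `^ s))) * (2^-1 * c1 * 4^-1 `^ s) * en `^ s)).
  rewrite ler_pM2r // [leLHS]mulrAC ler_pM2r // !mulr_gt0 ?pow0 ?invr_gt0 //.
have cc : 0 <= c2 * 2 `^ s * en `^ s by rewrite ltW // !mulr_gt0.
have := ler_wpM2l cc I2.
set l := (X in X <= _ -> _); set l' := (X in _ -> X <= _).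
have -> : l = l' by rewrite /l /l'; ring.
by move=> /le_trans; apply; rewrite le_eqVlt; apply/orP; left; apply/eqP; ring.
Unshelve. all: by end_near. Qed.

End disjoint_families.

(** * Families in all balls simultaneously, almost surely *)

Section almost_sure_families.
Context {R : realType} {X : metricType R}.
Context {d : measure_display} {Omega : measurableType d} (P : probability Omega R).
Context (s c1 c2 r0 b : R).
Local Notation H := (@hausdorff_measure R X s).
Local Notation m := (fun A : set X => fine (H A)).
Context (c1_gt0 : 0 < c1) (c2_gt0 : 0 < c2) (r0_gt0 : 0 < r0) (b_gt0 : 0 < b)
  (HX : H setT = 1%E)
  (ahlfors : forall (x : X) (r : R), 0 < r < r0 ->
     ((c1 * r `^ s)%:E <= H (ball x r) <= (c2 * r `^ s)%:E)%E).

Lemma ball_family_subset (A : nat -> set X) (W W' : set X) n u : W `<=` W' ->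
  ball_family b A W n u -> ball_family b A W' n u.
Proof.
move=> WW' [uu uW du]; split => // p /uW[? ? Wp].
by split => //; exact: WW'.
Qed.

(** Countably many balls suffice: at scale h = 1/(k+1) the centres run through a finite h-net, and
    B(y, 2h) lies in B(x, 3h) when y is within h of x. *)
Lemma ae_ball_family (A : Omega -> nat -> set X) (k0 : R) :
  (forall (x : X) (r : R) (n : nat) (e : R),
    0 < r < r0 -> 0 < e -> exists G : set Omega,
    [/\ measurable G, (P G <= e%:E)%E & forall w, ~ G w ->
      exists u, ball_family b (A w) (ball x (2 * r)) n u /\
        k0 * r `^ s <= \sum_(p <- u) critical_radius b p.2 `^ s]) ->
  {ae P, forall w, forall (k n : nat) (x : X), k.+1%:R^-1 < r0 ->
    exists u, ball_family b (A w) (ball x (3 * k.+1%:R^-1)) n u /\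
      k0 * k.+1%:R^-1 `^ s <= \sum_(p <- u) critical_radius b p.2 `^ s}.
Proof.
move=> likely.
(* A point serving as the default value of [nth]; it exists because the space has measure 1. *)
have [x0 _] : [set: X] !=set0.
  apply/set0P/eqP => X0; move: HX; rewrite X0 hausdorff_measure0 => /eqP.
  by rewrite eqe eq_sym oner_eq0.
have hk (k : nat) : 0 < k.+1%:R^-1 :> R by rewrite invr_gt0 ltr0n.
have /choice[xs xsP] : forall k : nat, exists xs : seq X, k.+1%:R^-1 < r0 ->
    forall y, exists2 x, x \in xs & mdist x y < k.+1%:R^-1.
  move=> k; have [kr|_] := ltP (k.+1%:R^-1) r0; last by exists [::].
  have [xs [_ _ h]] := exists_net c1_gt0 HX ahlfors setT (hk k) kr.
  by exists xs => _ y; exact: h.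
have ae3 k n i : {ae P, forall w, k.+1%:R^-1 < r0 ->
    exists u, ball_family b (A w) (ball (nth x0 (xs k) i) (2 * k.+1%:R^-1)) n u /\
      k0 * k.+1%:R^-1 `^ s <= \sum_(p <- u) critical_radius b p.2 `^ s}.
  apply: ae_of_small_exceptions => e e0.
  have [kr|kr] := ltP (k.+1%:R^-1) r0; last first.
    by exists set0; rewrite measure0 lee_fin ltW.
  have kr' : 0 < (k.+1%:R^-1 : R) < r0 by apply/andP; split; [exact: hk|].
  have [G [mG Ge GP]] := likely (nth x0 (xs k) i) k.+1%:R^-1 n e kr' e0.
  by exists G; split => // w /GP.
have := ae_foralln (fun k => ae_foralln (fun n => ae_foralln (fun i => ae3 k n i))).
apply: filterS => w h k n x kr.
have [y yxs yx] := xsP k kr x.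
have [u [fu su]] := h k n (index y (xs k)) kr.
exists u; split => //; apply: ball_family_subset fu => z.
rewrite nth_index // => /ballP yz; apply/ballP.
have := metric_triangle x y z; rewrite (metric_sym x y); move: (hk k).
move: (k.+1%:R^-1 : R) yx yz => v *; lra.
Qed.

(** The families about the points of an 8h-net of [V] are put together, the radii of their members
    being less than h. *)
Lemma ball_family_of_set (A : nat -> set X) (k0 : R) : 0 < k0 ->
  (forall (k n : nat) (x : X), k.+1%:R^-1 < r0 ->
    exists u, ball_family b A (ball x (3 * k.+1%:R^-1)) n u /\
      k0 * k.+1%:R^-1 `^ s <= \sum_(p <- u) critical_radius b p.2 `^ s) ->
  exists2 k1 : R, 0 < k1 & forall (V : set X) (eta : R) (n : nat), 0 < eta ->
    exists u, ball_family b A [set z | exists2 v, V v & mdist v z < eta] n u /\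
      k1 * m V <= \sum_(p <- u) critical_radius b p.2 `^ s.
Proof.
move=> k00 fam; have p8 : 0 < 8 `^ s :> R by rewrite powR_gt0.
exists (k0 / (c2 * 8 `^ s)); first by rewrite divr_gt0 // mulr_gt0.
move=> V eta n eta0.
have [k kP] : exists k : nat, 8 * k.+1%:R^-1 < Num.min r0 eta.
  have pos : 0 < Num.min r0 eta / 8 by rewrite divr_gt0 // lt_min r0_gt0.
  near \oo => k; exists k; rewrite mulrC -ltr_pdivlMr //; near: k.
  exact: near_infty_natSinv_lt (PosNum pos).
have {}fam := fam k.
have : 0 < k.+1%:R^-1 :> R by rewrite invr_gt0 ltr0n.
move: (k.+1%:R^-1 : R) kP fam => h; rewrite lt_min => /andP[hr0 heta] fam h0.
have [||vs [[uvs dvs] vsV net]] := exists_net c1_gt0 HX ahlfors V (e := 8 * h); [lra|by []|].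
have [n0 n0P] := @natS_powRN_small R b^-1 h (ltac:(by rewrite invr_gt0)) h0.
suff [u [fu su]] : exists u, ball_family b A [set z | exists2 v, v \in vs & mdist v z < 3 * h] (maxn n n0) u /\
    (size vs)%:R * (k0 * h `^ s) <= \sum_(p <- u) critical_radius b p.2 `^ s.
  exists u; split.
    case: fu => uu uW du; split => // p /uW[np Ap [v vvs vp]]; split => //.
      by apply: leq_trans np; exact: leq_maxl.
    by exists v; [exact: vsV|lra].
  apply: le_trans su.
  have := net_size HX ahlfors _ hr0 net; rewrite mulr_gt0 // => /(_ isT).
  rewrite powRM ?(ltW h0) // => mV.
  rewrite mulrAC ler_pdivrMr ?mulr_gt0 //.
  apply: le_trans (ler_wpM2l (ltW k00) mV) _.
  by rewrite le_eqVlt; apply/orP; left; apply/eqP; ring.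
have hr : h < r0 by lra.
elim: vs uvs dvs {vsV net} => [_ _|v vs ih /= /andP[vvs uvs] dvs].
  by exists [::]; split; [split|rewrite mul0r big_nil].
have [|u [[uu uW du] su]] := ih uvs.
  by move=> x y xx yy; apply: dvs; rewrite inE ?xx ?yy orbT.
have [u' [[uu' uW' du'] su']] := fam (maxn n n0) v hr.
(* A common point of two such balls would put their net points at distance less than 3h + h + h + 3h
   = 8h. *)
have far p q : p \in u' -> q \in u -> forall z, mdist p.1 z < critical_radius b p.2 ->
    mdist q.1 z < critical_radius b q.2 -> False.
  move=> pu' qu z pz qz.
  have [np _ /ballP vp] := uW' _ pu'; have [nq _ [v' v'vs v'q]] := uW _ qu.
  have rp : critical_radius b p.2 < h by apply: n0P; apply: leq_trans np; exact: leq_maxr.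
  have rq : critical_radius b q.2 < h by apply: n0P; apply: leq_trans nq; exact: leq_maxr.
  have vv' : v != v' by apply: contraNneq vvs => ->.
  have v'V : v' \in v :: vs by rewrite inE v'vs orbT.
  have := dvs v v' (mem_head _ _) v'V vv'.
  have := metric_triangle v p.1 v'; have := metric_triangle p.1 z v'.
  have := metric_triangle z q.1 v'.
  rewrite (metric_sym z q.1) (metric_sym q.1 v'); lra.
exists (u' ++ u); split.
- split.
  + rewrite cat_uniq uu' uu andbT; apply/hasPn => p pu; apply/negP => pu'.
    by apply: (far p p pu' pu p.1); rewrite mdistxx; exact: critical_radius_gt0.
  + move=> p; rewrite mem_cat => /orP[/uW'[np Ap /ballP vp]|/uW[np Ap [v' v'vs v'p]]].
      by split => //; exists v; rewrite ?mem_head.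
    by split => //; exists v' => //; rewrite inE v'vs orbT.
  + move=> p q z; rewrite !mem_cat => /orP[pu|pu] /orP[qu|qu] pz qz.
    * exact: (du' p q z).
    * by case: (far p q pu qu z).
    * by case: (far q p qu pu z).
    * exact: (du p q z).
- by rewrite big_cat /= -natr1 addrC mulrDl mul1r lerD.
Unshelve. all: by end_near. Qed.

End almost_sure_families.

Lemma ler_sum_subset {R : numDomainType} (I : eqType) (u v : seq I) (F : I -> R) :
  uniq u -> {subset u <= v} -> (forall i, 0 <= F i) ->
  \sum_(i <- u) F i <= \sum_(i <- v) F i.
Proof.
move=> uu uv F0; elim: u v uu uv => [v _ _|i u ih v /= /andP[iu uu] uv].
  by rewrite big_nil sumr_ge0.
rewrite big_cons [leRHS](big_rem i) /=; last by apply: uv; rewrite inE eqxx.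
rewrite lerD2l; apply: ih => // j ju.
  have ji : j != i by apply: contraNneq iu => <-.
by apply: rem_mem => //; apply: uv; rewrite inE ju orbT.
Qed.

(** * Mass transference *)

Section candidates.
Context {R : realType} {X : metricType R}.
Context (s c1 c2 r0 a b tau : R).
Local Notation H := (@hausdorff_measure R X s).
Local Notation m := (fun A : set X => fine (H A)).
Context (c1_gt0 : 0 < c1) (c2_gt0 : 0 < c2) (r0_gt0 : 0 < r0)
  (a_ge0 : 0 <= a) (b_gt0 : 0 < b) (sE : s = a + b)
  (tau_gt0 : 0 < tau) (tau_b : tau^-1 < b)
  (HX : H setT = 1%E)
  (ahlfors : forall (x : X) (r : R), 0 < r < r0 ->
     ((c1 * r `^ s)%:E <= H (ball x r) <= (c2 * r `^ s)%:E)%E).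
Local Notation t := (a + tau^-1).

Let pow0 (x p : R) : 0 < x -> 0 < x `^ p. Proof. exact: powR_gt0. Qed.

Let s_gt0 : 0 < s.
Proof. by rewrite sE ltr_wpDl. Qed.

Let t_gt0 : 0 < t.
Proof. by rewrite ltr_wpDl // invr_gt0. Qed.

Let t_lt_s : t < s.
Proof. by rewrite sE ltrD2l. Qed.

Definition limsup_radius (tau : R) (j : nat) : R := j.+1%:R `^ (- tau).

Lemma limsup_radius_gt0 j : 0 < limsup_radius tau j.
Proof. exact: powR_gt0. Qed.

(** Both sides are 1/(j+1). With delta and D for the two radii, this gives (D / delta)^a delta^t =
    D^s, which is what singles out the exponent t. *)
Lemma limsup_radius_pow j : limsup_radius tau j `^ tau^-1 = critical_radius b j `^ b.
Proof.
by rewrite critical_radius_pow // /limsup_radius -powRrM mulNr mulfV ?gt_eqF // powR_inv1.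
Qed.

Lemma limsup_radius_small (e : R) : 0 < e ->
  exists N : nat, forall j, (N <= j)%N -> limsup_radius tau j <= e * critical_radius b j.
Proof.
move=> e0; have p0 : 0 < tau - b^-1.
  by rewrite subr_gt0 invf_plt // posrE.
have [N NP] := natS_powRN_small p0 e0; exists N => j /NP h.
rewrite /limsup_radius (_ : - tau = - (tau - b^-1) + - b^-1); last by rewrite opprB addrAC subrr sub0r.
rewrite powRD ?pnatr_eq0 ?implybT // ler_pM2r; first exact: ltW.
exact: powR_gt0.
Qed.

(* The charge of a ball B(y, r) of the cover to one ball B(z, D) of a disjoint family:
   each of the small balls B(l, delta) met by B(y, r) receives min(r, delta)^t. *)
Lemma capped_candidate_sum (A : set X) (Cu rm delta D r : R) (z y : X) (L : seq X) :
  0 < Cu -> upper_nets a Cu rm A -> A z -> 0 < delta -> 8 * delta <= D -> 4 * D < rm ->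
  delta `^ tau^-1 = D `^ b -> 0 < r -> r <= 1 ->
  dispersed (4 * delta) L -> (forall l, l \in L -> A l /\ mdist z l < D / 2) ->
  \sum_(l <- L | `[< mdist l y < delta + r >]) Num.min r delta `^ t <=
    Cu * (Num.min D r `^ s * r `^ (t - s)).
Proof.
move=> Cu0 netA Az delta0 deltaD Drm deltaE r_gt0 r1 dL LA.
have D0 : 0 < D by lra.
have powt u : 0 < u -> u `^ t = u `^ a * u `^ tau^-1.
  by move=> u0; rewrite powRD // (gt_eqF u0) implybT.
have cancel4 u v : 0 < u -> 0 < v -> forall n : R, n * (4 * u) `^ a <= Cu * (4 * v) `^ a ->
    n * u `^ a <= Cu * v `^ a.
  move=> u0 v0 n; rewrite !powRM ?(ltW u0) ?(ltW v0) //.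
  rewrite mulrCA [leRHS]mulrCA ler_pM2l //; exact: pow0.
(* If r >= D, all of [L] is counted: about (D / delta)^a points weighing delta^t, that is D^s in
   total, and r^(t - s) >= 1 because r <= 1 and t < s. *)
have [Dr|rD] := leP D r.
  apply: (@le_trans _ _ (\sum_(l <- L) delta `^ t)).
    rewrite big_mkcond; apply: ler_sum => l _; case: ifP => _; last exact: powR_ge0.
    apply: ge0_ler_powR; rewrite ?nnegrE ?(ltW t_gt0) ?(ltW delta0) //.
      by rewrite le_min !ltW.
    by rewrite ge_min lexx orbT.
  rewrite big_const_seq count_predT iter_addr_0 -mulr_natl.
  have h : (size L)%:R * (4 * delta) `^ a <= Cu * (4 * D) `^ a.
    apply: (le_trans (netA z L (4 * delta) (D / 2) Az _ _ dL LA)); [lra|lra|].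
    rewrite ler_pM2l //; apply: ge0_ler_powR => //; rewrite ?nnegrE; lra.
  have {}h := cancel4 _ _ delta0 D0 _ h.
  apply: (@le_trans _ _ (Cu * (D `^ a * D `^ b))).
    by rewrite powt // deltaE !mulrA ler_pM2r ?pow0.
  have -> : D `^ a * D `^ b = D `^ s.
    by rewrite sE powRD // (gt_eqF D0) implybT.
  rewrite ler_pM2l // ler_peMr ?powR_ge0 //.
  rewrite -[t - s]opprB powRN invf_ge1 ?pow0 //.
  have -> : 1 = 1 `^ (s - t) :> R by rewrite powR1.
  by apply: ge0_ler_powR; rewrite ?nnegrE ?subr_ge0 ?ler01 ?(ltW r_gt0) ?(ltW t_lt_s).
have -> : r `^ s * r `^ (t - s) = r `^ t.
  by rewrite -powRD ?(gt_eqF r_gt0) ?implybT // addrC subrK.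
(* If r < D, the points met lie within 4M of each other, so [upper_nets] allows at most Cu (M /
   delta)^a of them. *)
set M := Num.max delta r.
have M1 : delta <= M by rewrite le_max lexx.
have M2 : r <= M by rewrite le_max lexx orbT.
have M0 : 0 < M by exact: lt_le_trans M1.
have MD : M < D by rewrite gt_max rD andbT; lra.
rewrite -big_filter; set L' := [seq _ <- _ | _].
rewrite big_const_seq count_predT iter_addr_0 -mulr_natl.
have h : (size L')%:R * delta `^ a <= Cu * M `^ a.
  apply: cancel4 => //.
  have L'P l : l \in L' -> l \in L /\ mdist l y < delta + r.
    by rewrite mem_filter => /andP[/asboolP].
  have dL' : dispersed (4 * delta) L'.
    case: dL => uL dL; split; first exact: filter_uniq.
    by move=> u v /L'P[uu _] /L'P[vv _]; exact: dL.
  have [->|[l0 l0L]] : L' = [::] \/ exists l, l \in L'.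
  - by case: L' {L'P dL'} => [|l l']; [left|right; exists l; rewrite inE eqxx].
  - by rewrite mul0r mulr_ge0 ?powR_ge0 ?ltW.
  apply: (netA l0 L' (4 * delta) (4 * M)) => //.
  - exact: (LA _ (L'P _ l0L).1).1.
  - by apply/andP; split; lra.
  - lra.
  move=> l lL'; have [lL ly] := L'P _ lL'; split; first exact: (LA _ lL).1.
  have := (L'P _ l0L).2; have := metric_triangle l0 y l; rewrite (metric_sym y l); lra.
(* For r < delta a bounded number of points receive r^t each. Otherwise the total is of order (r /
   delta)^a delta^t, which is at most r^t. *)
have [rdelta|deltar] := ltP r delta.
  have ME : M = delta by apply/max_idPl; exact: ltW.
  by rewrite ler_pM2r ?pow0 //; move: h; rewrite ME ler_pM2r ?pow0.
have ME : M = r by apply/max_idPr.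
rewrite !powt // !mulrA; apply: ler_pM; rewrite ?mulr_ge0 ?powR_ge0 //.
  by rewrite -ME.
by apply: ge0_ler_powR; rewrite ?nnegrE ?invr_ge0 ?(ltW tau_gt0) ?(ltW delta0) ?(ltW r_gt0).
Qed.

(** The balls of radius min(D_i, r)/4 about q_i stay inside the disjoint balls B(p_i, D_i), and
    their halves inside B(y, 2r); compare volumes. This limits what one ball of the cover pays to a
    whole family. *)
Lemma disjoint_min_sum (I : eqType) (u : seq I) (p q : I -> X) (D : I -> R) (y : X) (r : R) :
  uniq u -> 0 < r -> 2 * r < r0 -> (forall i, i \in u -> 0 < D i) ->
  (forall i j x, i \in u -> j \in u -> mdist (p i) x < D i ->
     mdist (p j) x < D j -> i = j) ->
  (forall i, i \in u -> mdist (p i) (q i) < 3 / 4 * D i /\ mdist y (q i) < r) ->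
  \sum_(i <- u) Num.min (D i) r `^ s <= c2 * 16 `^ s / c1 * r `^ s.
Proof.
move=> uu r_gt0 rr0 D0 disj pq.
have rle i : Num.min (D i) r <= r by rewrite ge_min lexx orbT.
have rleD i : Num.min (D i) r <= D i by rewrite ge_min lexx.
have min0 i : i \in u -> 0 < Num.min (D i) r by move=> iu; rewrite lt_min D0.
have : \sum_(i <- u) c1 * ((Num.min (D i) r / 4) / 2) `^ s <= m (ball y (2 * r)).
  apply: (sum_disjoint_balls HX ahlfors (p := q)) => //.
  - by move=> i iu; have := rle i; have := min0 i iu; move=> *; apply/andP; split; lra.
  - move=> i j x iu ju qi qj; apply: (disj i j x) => //.
      by have := metric_triangle (p i) (q i) x; have := (pq _ iu).1; have := rleD i; lra.
    by have := metric_triangle (p j) (q j) x; have := (pq _ ju).1; have := rleD j; lra.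
  - move=> i iu x /ballP qx; apply/ballP.
    by have := metric_triangle y (q i) x; have := (pq _ iu).2; have := rle i; lra.
have r2 : 0 < 2 * r < r0 by apply/andP; split; lra.
move=> /le_trans/(_ (ahlfors_le HX ahlfors y r2)).
have -> : \sum_(i <- u) c1 * (Num.min (D i) r / 4 / 2) `^ s =
    c1 * 8^-1 `^ s * \sum_(i <- u) Num.min (D i) r `^ s.
  rewrite mulr_sumr big_seq [RHS]big_seq; apply: eq_bigr => i iu.
  rewrite (_ : Num.min (D i) r / 4 / 2 = 8^-1 * Num.min (D i) r); last by field.
  by rewrite powRM ?invr_ge0 ?mulrA // ltW // min0.
move=> h; rewrite mulrAC ler_pdivlMr //.
have p8 : 0 < 8 `^ s :> R by exact: pow0.
rewrite -(ler_pM2l p8) in h.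
have e1 : 8 `^ s * (c1 * 8^-1 `^ s * \sum_(i <- u) Num.min (D i) r `^ s) =
    (\sum_(i <- u) Num.min (D i) r `^ s) * c1.
  rewrite (_ : 8^-1 `^ s = (8 `^ s)^-1); last by rewrite -powR_inv1 // -powRrM mulrC powRrM powR_inv1 ?powR_ge0.
  by field; rewrite gt_eqF.
rewrite e1 in h; apply: le_trans h _.
rewrite powRM ?(ltW r_gt0) // (_ : 16 = 8 * 2 :> R); last by ring.
by rewrite powRM // le_eqVlt; apply/orP; left; apply/eqP; ring.
Qed.

End candidates.

(** * Unordered sums and finite lists *)

Section esum_seq.
Context {R : realType} {I : choiceType} (F : I -> R).

Lemma esum_ge_seq (B : set I) (u : seq I) : uniq u -> (forall i, i \in u -> B i) ->
  ((\sum_(i <- u) F i)%:E <= \esum_(i in B) (F i)%:E)%E.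
Proof.
move=> uu uB; apply: esum_ge; exists [set` u]; first by split.
by rewrite -fsbig_seq // sumEFin.
Qed.

Lemma esum_gt_seq (B : set I) (y : R) : (y%:E < \esum_(i in B) (F i)%:E)%E ->
  exists u : seq I, [/\ uniq u, forall i, i \in u -> B i & y < \sum_(i <- u) F i].
Proof.
move=> /ereal_sup_gt[_ [A [fA AB] <-]].
rewrite fsbig_finite //= sumEFin lte_fin => yA.
exists (fset_set A); split; [exact: fset_uniq| |exact: yA].
by move=> i; rewrite in_fset_set // inE => /AB.
Qed.

End esum_seq.

(** * Double counting of candidate balls against the cover *)

Section good_candidate.
Context {R : realType} {X : metricType R}.
Context (s c1 c2 r0 a b tau : R).
Local Notation H := (@hausdorff_measure R X s).
Context (c1_gt0 : 0 < c1) (c2_gt0 : 0 < c2) (r0_gt0 : 0 < r0)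
  (a_ge0 : 0 <= a) (b_gt0 : 0 < b) (sE : s = a + b)
  (tau_gt0 : 0 < tau) (tau_b : tau^-1 < b)
  (HX : H setT = 1%E)
  (ahlfors : forall (x : X) (r : R), 0 < r < r0 ->
     ((c1 * r `^ s)%:E <= H (ball x r) <= (c2 * r `^ s)%:E)%E).
Local Notation t := (a + tau^-1).
Local Notation D := (critical_radius b).
Local Notation dl := (limsup_radius tau).

Let pow0 (x p : R) : 0 < x -> 0 < x `^ p. Proof. exact: powR_gt0. Qed.

(** The hypothesis says that a net has at least of order (D0 / delta)^a points; at weight delta^t
    each, they recover the volume D0^s. *)
Lemma net_mass_ge (cl D0 delta n : R) : 0 < D0 -> 0 < delta ->
  delta `^ tau^-1 = D0 `^ b -> cl * (D0 / 2) `^ a <= n * (4 * delta) `^ a ->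
  cl * 8^-1 `^ a * D0 `^ s <= n * delta `^ t.
Proof.
move=> D_gt0 delta0 deltaE h.
rewrite sE !powRD ?(gt_eqF D_gt0) ?(gt_eqF delta0) ?implybT // deltaE !mulrA.
rewrite ler_pM2r ?pow0 //.
have p4 : 0 < 4 `^ a :> R by exact: pow0.
rewrite -(ler_pM2r p4); move: h; rewrite !powRM ?(ltW D_gt0) ?(ltW delta0) ?invr_ge0 //.
have -> : 2^-1 `^ a = 8^-1 `^ a * 4 `^ a :> R.
  by rewrite -powRM ?invr_ge0 //; congr (_ `^ _); field.
set x := (X in X <= _ -> _); set x' := (X in _ -> X <= _).
have -> : x' = x by rewrite /x /x'; ring.
by move=> /le_trans; apply; rewrite le_eqVlt; apply/orP; left; apply/eqP; ring.
Qed.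

Definition meets (z : X) (r : R) : set (X * R) :=
  [set q | exists2 x, mdist z x < r & mdist q.1 x < q.2].

(** If every candidate were heavily covered, each would collect at least eps delta^t, hence the
    family at least eps kl times the sum of D^s. Each covering ball of radius r pays at most ku r^t
    in all. The ratio of the constants is [cst]. *)
Lemma exists_good_candidate (A : nat -> set X) (cl Cu rm eps : R) :
  0 < cl -> 0 < Cu -> 0 < rm -> 0 < eps -> eps <= 1 ->
  (forall j, lower_nets a cl rm (A j)) -> (forall j, upper_nets a Cu rm (A j)) ->
  exists cst : R, exists nst : nat, 0 < cst /\
  forall (W : set X) (n : nat) (u : seq (X * nat)) (B : set (X * R)), (nst <= n)%N ->
    ball_family b A W n u ->
    (forall q, B q -> [/\ 0 < q.2, q.2 <= 1 & 2 * q.2 < r0]) ->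
    (\esum_(q in B) (q.2 `^ t)%:E < (cst * \sum_(p <- u) D p.2 `^ s)%:E)%E ->
    exists l j v, [/\ (n <= j)%N, A j l, W v, mdist v l < D j &
      (\esum_(q in B `&` meets l (dl j)) (q.2 `^ t)%:E <= (eps * dl j `^ t)%:E)%E].
Proof.
have arith1 (x y : R) : 0 < x -> 8 * x <= y -> 0 < 4 * x <= y / 2.
  by move=> *; apply/andP; split; lra.
have arith2 (x y : R) : 0 < x -> 4 * x < y -> x / 2 < y by lra.
have arith3 (x y z u v : R) : 0 < u -> 8 * v <= u -> z <= x + y -> x < u / 2 -> y < v ->
  z < 3 / 4 * u by lra.
have arith4 (x y z u v : R) : z <= x + y -> x < u -> y < v -> z < u + v by lra.
have arith5 (x u : R) : 0 < u -> x < u / 2 -> x < u by lra.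
move=> cl0 Cu0 rm0 eps0 eps1 lowA uppA.
have [n1 n1P] := limsup_radius_small b_gt0 tau_gt0 tau_b (ltac:(by rewrite invr_gt0) : 0 < 8^-1).
have [n2 n2P] := @natS_powRN_small R b^-1 (rm / 4) (ltac:(by rewrite invr_gt0)) (ltac:(by rewrite divr_gt0)).
set kl := cl * 8^-1 `^ a.
set ku := Cu * (c2 * 16 `^ s / c1).
have kl0 : 0 < kl by rewrite mulr_gt0 // pow0.
have ku0 : 0 < ku by rewrite !mulr_gt0 ?invr_gt0 ?pow0.
exists (eps * kl / ku), (maxn n1 n2); split; first by rewrite divr_gt0 // mulr_gt0.
move=> W n u B; rewrite geq_max => /andP[n1n n2n] [uu uW du] BP sumB.
apply: contrapT => nex.
have dlD j : (n <= j)%N -> 8 * dl j <= D j.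
  by move=> nj; rewrite -ler_pdivlMl //; exact: n1P (leq_trans n1n nj).
have Drm j : (n <= j)%N -> 4 * D j < rm.
  by move=> nj; rewrite mulrC -ltr_pdivlMr //; exact: n2P (leq_trans n2n nj).
have dl0 j : 0 < dl j by exact: limsup_radius_gt0.
have D0 j : 0 < D j by exact: critical_radius_gt0.
have /choice[L LP] : forall p : X * nat, exists L : seq X, p \in u ->
    [/\ dispersed (4 * dl p.2) L, forall l, l \in L -> A p.2 l /\ mdist p.1 l < D p.2 / 2 &
     cl * (D p.2 / 2) `^ a <= (size L)%:R * (4 * dl p.2) `^ a].
  move=> p; have [pu|_] := boolP (p \in u); last by exists [::].
  have [np Ap _] := uW _ pu; have h1 := dlD _ np; have h2 := Drm _ np.
  have h3 := D0 p.2; have h4 := dl0 p.2.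
  have e1 : 0 < 4 * dl p.2 <= D p.2 / 2 by exact: arith1.
  have e2 : D p.2 / 2 < rm by exact: arith2.
  by have [L Lh] := lowA p.2 p.1 _ _ Ap e1 e2; exists L.
(* For each candidate finitely many covering balls already exceed the bound, so the double counting
   takes place in finite sums. *)
have /choice[TT TTP] : forall c : (X * nat) * X, exists T : seq (X * R),
    c.1 \in u -> c.2 \in L c.1 -> [/\ uniq T,
     forall q, q \in T -> B q /\ meets c.2 (dl c.1.2) q &
     eps * dl c.1.2 `^ t < \sum_(q <- T) q.2 `^ t].
  move=> [p l] /=; have [pu|_] := boolP (p \in u); last by exists [::].
  have [lL|_] := boolP (l \in L p); last by exists [::].
  have [np Ap Wp] := uW _ pu; have [_ LA _] := LP _ pu; have [Al pl] := LA _ lL.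
  have /esum_gt_seq[T [uT TB hT]] : ((eps * dl p.2 `^ t)%:E <
      \esum_(q in B `&` meets l (dl p.2)) (q.2 `^ t)%:E)%E.
    rewrite ltNge; apply/negP => h; apply: nex; exists l, p.2, p.1; split => //.
    exact: arith5 (D0 _) pl.
  by exists T => _ _; split => // q /TB[].
pose cands := [seq (p, l) | p <- u, l <- L p].
pose T := undup (flatten (map TT cands)).
have TB q : q \in T -> B q.
  rewrite mem_undup => /flattenP[_ /mapP[c + ->] qc].
  move=> /allpairsPdep[p [l [pu lL cE]]]; rewrite cE in qc.
  by have [_ /(_ _ qc)[]] := TTP (p, l) pu lL.
have TTT p l : p \in u -> l \in L p -> {subset TT (p, l) <= T}.
  move=> pu lL q qT; rewrite mem_undup; apply/flattenP; exists (TT (p, l)) => //.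
  by apply: map_f; apply/allpairsPdep; exists p, l.
(* Capping the radii at [dl] does no harm: a ball of radius at least [dl] alone contributes dl^t,
   and eps <= 1; without such a ball nothing is capped. *)
have candP p l : p \in u -> l \in L p -> eps * dl p.2 `^ t <=
    \sum_(q <- T | `[< meets l (dl p.2) q >]) Num.min q.2 (dl p.2) `^ t.
  move=> pu lL; have [uT TTB hT] := TTP (p, l) pu lL.
  apply: (@le_trans _ _ (\sum_(q <- TT (p, l)) Num.min q.2 (dl p.2) `^ t)); last first.
    rewrite -[leRHS]big_filter; apply: ler_sum_subset => //.
      move=> q qT; rewrite mem_filter (TTT p l) // andbT; apply/asboolP.
      exact: (TTB _ qT).2.
    by move=> q; exact: powR_ge0.
  have [[q qT dlq]|nq] := pselect (exists2 q, q \in TT (p, l) & dl p.2 <= q.2).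
    rewrite (big_rem q) //= (_ : Num.min q.2 _ = dl p.2); last by apply/min_idPr.
    apply: (@le_trans _ _ (dl p.2 `^ t)).
      by rewrite ler_piMl // powR_ge0.
    by rewrite lerDl sumr_ge0 // => *; exact: powR_ge0.
  apply: le_trans (ltW hT) _; rewrite big_seq [leRHS]big_seq; apply: ler_sum => q qT.
  rewrite (_ : Num.min q.2 _ = q.2) //; apply/min_idPl.
  by rewrite leNgt; apply/negP => h; apply: nq; exists q => //; exact: ltW.
have lower p : p \in u -> eps * kl * D p.2 `^ s <=
    \sum_(l <- L p) \sum_(q <- T | `[< meets l (dl p.2) q >]) Num.min q.2 (dl p.2) `^ t.
  move=> pu; apply: (@le_trans _ _ (\sum_(l <- L p) eps * dl p.2 `^ t)); last first.
    by rewrite big_seq [leRHS]big_seq; apply: ler_sum => l; exact: candP.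
  rewrite big_const_seq count_predT iter_addr_0 -mulr_natl.
  rewrite [leRHS]mulrCA -[leLHS]mulrA (ler_pM2l eps0).
  have [_ _ h] := LP _ pu.
  exact: net_mass_ge (D0 _) (dl0 _) (limsup_radius_pow b_gt0 tau_gt0 _) h.
(* [capped_candidate_sum] bounds the payment to one member of the family, and [disjoint_min_sum]
   sums over the members met; the powers q^(t - s) and q^s combine to q^t. *)
have upper q : q \in T ->
    \sum_(p <- u) \sum_(l <- L p | `[< meets l (dl p.2) q >])
      Num.min q.2 (dl p.2) `^ t <= ku * q.2 `^ t.
  move=> /TB/BP[q0 q1 qr0].
  pose v := [seq p <- u | has (fun l => `[< meets l (dl p.2) q >]) (L p)].
  have /choice[x xP] : forall p, exists x, p \in v -> mdist p.1 x < 3 / 4 * D p.2 /\ mdist q.1 x < q.2.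
    move=> p; have [|_] := boolP (p \in v); last by exists q.1.
    rewrite mem_filter => /andP[/hasP[l lL /asboolP[x lx qx]] pu]; exists x => _.
    split => //; have [np _ _] := uW _ pu; have [_ LA _] := LP _ pu.
    exact: arith3 (D0 _) (dlD _ np) (metric_triangle p.1 l x) (LA _ lL).2 lx.
  have vu p : p \in v -> p \in u by rewrite mem_filter => /andP[].
  have hv : \sum_(p <- v) Num.min (D p.2) q.2 `^ s <= c2 * 16 `^ s / c1 * q.2 `^ s.
    apply: (disjoint_min_sum c1_gt0 HX ahlfors (p := fst) (q := x) (y := q.1)) => //.
      exact: filter_uniq.
    by move=> p p' z /vu pu /vu p'u; exact: du.
  have -> : ku * q.2 `^ t = Cu * q.2 `^ (t - s) * (c2 * 16 `^ s / c1 * q.2 `^ s).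
    have -> : q.2 `^ t = q.2 `^ (t - s) * q.2 `^ s.
      by rewrite -powRD ?(gt_eqF q0) ?implybT // subrK.
    by rewrite /ku; ring.
  have C0 : 0 < Cu * q.2 `^ (t - s) by rewrite mulr_gt0 // pow0.
  apply: le_trans (ler_wpM2l (ltW C0) hv).
  rewrite mulr_sumr [leRHS]big_filter [leRHS]big_mkcond.
  rewrite big_seq [leRHS]big_seq; apply: ler_sum => p pu.
  have [np Ap Wp] := uW _ pu; have [dL LA _] := LP _ pu.
  case: ifPn => [_|nm]; last first.
    rewrite big_seq_cond big1 // => l /andP[lL ml].
    by move/hasPn: nm => /(_ _ lL); rewrite ml.
  rewrite -mulrA [_ `^ (t - s) * _]mulrC.
  apply: le_trans (capped_candidate_sum a_ge0 sE tau_gt0 tau_b q.1 Cu0 (uppA p.2) Ap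
    (dl0 _) (dlD _ np) (Drm _ np) (limsup_radius_pow b_gt0 tau_gt0 _) q0 q1 dL LA).
  rewrite big_mkcond [leRHS]big_mkcond; apply: ler_sum => l _.
  have [[y ly qy]|_] := asboolP (meets l (dl p.2) q).
    rewrite ifT //; apply/asboolP.
    by apply: arith4 (metric_triangle l y q.1) ly _; rewrite metric_sym.
  by case: ifP => _ //; exact: powR_ge0.
have : eps * kl * \sum_(p <- u) D p.2 `^ s <= ku * \sum_(q <- T) q.2 `^ t.
  rewrite !mulr_sumr; apply: (@le_trans _ _ (\sum_(p <- u) \sum_(l <- L p)
      \sum_(q <- T | `[< meets l (dl p.2) q >]) Num.min q.2 (dl p.2) `^ t)).
    by rewrite big_seq [leRHS]big_seq; apply: ler_sum => p /lower.
  apply: (@le_trans _ _ (\sum_(q <- T) \sum_(p <- u)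
      \sum_(l <- L p | `[< meets l (dl p.2) q >]) Num.min q.2 (dl p.2) `^ t)); last first.
    by rewrite big_seq [leRHS]big_seq; apply: ler_sum => q /upper.
  rewrite [leRHS]exchange_big /=; apply: ler_sum => p _.
  rewrite le_eqVlt; apply/orP; left; apply/eqP.
  rewrite (exchange_big_dep predT) //=; apply: eq_bigr => q _.
have hT := le_lt_trans (esum_ge_seq (fun q : X * R => q.2 `^ t) (undup_uniq _) TB) sumB.
move: hT; rewrite lte_fin => hT.
rewrite leNgt => /negP; apply.
by move: hT; rewrite mulrAC ltr_pdivlMr // mulrC.
Qed.

End good_candidate.

Lemma infinite_set_natP (S : set nat) :
  infinite_set S <-> forall N, exists2 j, (N <= j)%N & S j.
Proof.
split=> [iS N|h /finite_seqP[u Su]].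
  apply: contrapT => nex; apply: iS; apply: (sub_finite_set _ (finite_II N)) => j Sj /=.
  by rewrite ltnNge; apply/negP => Nj; apply: nex; exists j.
have [j jN] := h (\max_(i <- u) i).+1; rewrite Su /= => ju.
by move: jN; rewrite ltnNge (leq_bigmax_seq j ju).
Qed.

(** * Existence of lightly covered balls *)

Section mass_transference.
Context {R : realType} {X : metricType R}.
Context (s c1 c2 r0 a b tau : R).
Local Notation H := (@hausdorff_measure R X s).
Local Notation m := (fun A : set X => fine (H A)).
Context (c1_gt0 : 0 < c1) (c2_gt0 : 0 < c2) (r0_gt0 : 0 < r0)
  (a_ge0 : 0 <= a) (b_gt0 : 0 < b) (sE : s = a + b)
  (tau_gt0 : 0 < tau) (tau_b : tau^-1 < b)
  (HX : H setT = 1%E)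
  (ahlfors : forall (x : X) (r : R), 0 < r < r0 ->
     ((c1 * r `^ s)%:E <= H (ball x r) <= (c2 * r `^ s)%:E)%E).
Local Notation t := (a + tau^-1).
Local Notation D := (critical_radius b).
Local Notation dl := (limsup_radius tau).

Let pow0 (x p : R) : 0 < x -> 0 < x `^ p. Proof. exact: powR_gt0. Qed.

Let t_gt0 : 0 < t.
Proof. by rewrite ltr_wpDl // invr_gt0. Qed.

Let t_lt_s : t < s.
Proof. by rewrite sE ltrD2l. Qed.

(** The radii of the removed balls are doubled so that the remaining points keep a distance of at
    least [q.2] from the original ball. *)
Lemma hausdorff_setD_balls (V : set X) (S : seq (X * R)) :
  (forall q, q \in S -> 0 < q.2 /\ 2 * q.2 < r0) ->
  m V <= m (V `\` [set x | exists2 q, q \in S & mdist q.1 x < 2 * q.2]) +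
    c2 * 2 `^ s * \sum_(q <- S) q.2 `^ s.
Proof.
move=> SP; set V' := V `\` _.
pose F (i : option (X * R)) := if i is Some q then ball q.1 (2 * q.2) else V'.
apply: (@le_trans _ _ (\sum_(i <- None :: map Some S) m (F i))).
  apply: (fine_hausdorff_cover HX) => x Vx.
  have [[q qS qx]|nq] := pselect (exists2 q, q \in S & mdist q.1 x < 2 * q.2).
    exists (Some q); last by apply/ballP.
    by rewrite inE /= map_f.
  by exists None; rewrite ?inE.
rewrite big_cons lerD2l big_map mulr_sumr big_seq [leRHS]big_seq.
apply: ler_sum => q /SP[q0 qr].
have q2 : 0 < 2 * q.2 < r0 by rewrite mulr_gt0.
apply: le_trans (ahlfors_le HX ahlfors q.1 q2) _.
by rewrite powRM ?(ltW q0) // mulrA.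
Qed.

Lemma esum_tail (I : choiceType) (F : I -> R) (B : set I) (eta : R) :
  (forall i, 0 <= F i) -> 0 < eta -> (\esum_(i in B) (F i)%:E < +oo)%E ->
  exists S : seq I, [/\ uniq S, forall i, i \in S -> B i &
    (\esum_(i in B `&` ~` [set` S]) (F i)%:E < eta%:E)%E].
Proof.
move=> F0 eta0 fB.
have F0' i : (0 <= (F i)%:E)%E by rewrite lee_fin.
have B0 : (0 <= \esum_(i in B) (F i)%:E)%E by exact: esum_ge0.
have finB : (\esum_(i in B) (F i)%:E)%E \is a fin_num by rewrite ge0_fin_numE.
have [S [uS SB hS]] : exists u : seq I, [/\ uniq u, forall i, i \in u -> B i &
    fine (\esum_(i in B) (F i)%:E)%E - eta < \sum_(i <- u) F i].
  by apply: esum_gt_seq; rewrite -[ltRHS](fineK finB) lte_fin gtrBl.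
exists S; split => //.
have split : (\esum_(i in B) (F i)%:E)%E = (\esum_(i in B `&` [set` S]) (F i)%:E +
    \esum_(i in B `&` ~` [set` S]) (F i)%:E)%E by exact: esumID.
have h1 : ((\sum_(i <- S) F i)%:E <= \esum_(i in B `&` [set` S]) (F i)%:E)%E.
  by apply: esum_ge_seq => // i iS; split => //; exact: SB.
have finS : (\esum_(i in B `&` ~` [set` S]) (F i)%:E)%E \is a fin_num.
  rewrite ge0_fin_numE; last by exact: esum_ge0.
  by apply: le_lt_trans fB; apply: le_esum_set => i [].
have h2 : ((\sum_(i <- S) F i)%:E + \esum_(i in B `&` ~` [set` S]) (F i)%:E <=
    \esum_(i in B) (F i)%:E)%E by rewrite split; exact: leeD2r.
move: h2 hS; rewrite -(fineK finS) -(fineK finB) -EFinD !lee_fin lte_fin => h2 hS.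
lra.
Qed.

Section limsup.
Context (A : nat -> set X) (cl Cu rm k1 : R).
Context (cl_gt0 : 0 < cl) (Cu_gt0 : 0 < Cu) (rm_gt0 : 0 < rm) (k1_gt0 : 0 < k1)
  (lowA : forall j, lower_nets a cl rm (A j))
  (uppA : forall j, upper_nets a Cu rm (A j))
  (fam : forall (V : set X) (eta : R) (n : nat), 0 < eta ->
    exists u, ball_family b A [set z | exists2 v, V v & mdist v z < eta] n u /\
      k1 * m V <= \sum_(p <- u) critical_radius b p.2 `^ s).

Definition lightly_covered (B : set (X * R)) (eps : R) (p : X * nat) : Prop :=
  (\esum_(q in B `&` meets p.1 (dl p.2)) (q.2 `^ t)%:E <= (eps * dl p.2 `^ t)%:E)%E.

(** A finite part of [B0] is removed so that the rest has a sum too small to cover heavily all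
    candidates of a family near what is left of [V0]. The form serves both the first ball, with [V0]
    the whole space, and the passage from one ball to a smaller one. *)
Lemma exists_lightly_covered (B B0 : set (X * R)) (V0 : set X) (zeta mu eps : R) (n : nat) :
  0 < eps -> eps <= 1 ->
  (forall q, B q -> [/\ 0 < q.2, q.2 <= 1 & 2 * q.2 < r0]) -> B0 `<=` B ->
  0 < zeta -> 0 < mu -> (\esum_(q in B0) (q.2 `^ t)%:E < +oo)%E ->
  (forall q v x, B q -> V0 v -> mdist v x < zeta -> mdist q.1 x < q.2 -> B0 q) ->
  (forall S : seq (X * R), uniq S -> (forall q, q \in S -> B0 q) ->
    mu <= m (V0 `\` [set x | exists2 q, q \in S & mdist q.1 x < 2 * q.2])) ->
  exists p : X * nat, [/\ (n <= p.2)%N, A p.2 p.1, lightly_covered B eps p &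
    exists2 v, V0 v & forall x, mdist p.1 x <= dl p.2 -> mdist v x < zeta].
Proof.
have arith (v l x r dd v' : R) : 0 < r -> v < r / 2 -> l < r / 8 -> x <= dd -> 8 * dd <= r / 8 ->
  v' <= v + l + x -> v' < r by lra.
have arith2 (qv qx vx q r : R) : r <= q -> qv <= qx + vx -> qx < q -> vx < r -> qv < 2 * q by lra.
move=> eps0 eps1 BP B0B zeta0 mu0 fB0 nbhd mass.
have [cst [nst [cst0 cand]]] := exists_good_candidate c1_gt0 c2_gt0 a_ge0 b_gt0 sE
  tau_gt0 tau_b HX ahlfors cl_gt0 Cu_gt0 rm_gt0 eps0 eps1 lowA uppA.
(* The family near the remaining set has a sum of D^s of at least k1 mu, so a tail below this number
   meets the requirement of [exists_good_candidate]. *)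
have cst_mu : 0 < cst * (k1 * mu) by rewrite !mulr_gt0.
have [S [uS SB0 tail]] := esum_tail (fun q : X * R => powR_ge0 q.2 t) cst_mu fB0.
(* Below this scale, a ball near a remaining point meets no removed ball and stays in the
   [zeta]-neighbourhood of [V0]. *)
have [xi [xi0 xizeta xiS]] : exists xi, [/\ 0 < xi, xi <= zeta & forall q, q \in S -> xi <= q.2].
  elim: S SB0 {uS tail} => [|q S ih] SB0; first by exists zeta.
  have [|xi [xi0 xz xS]] := ih; first by move=> q' q'S; apply: SB0; rewrite inE q'S orbT.
  have [q0 _ _] : [/\ 0 < q.2, q.2 <= 1 & 2 * q.2 < r0].
    by apply/BP/B0B/SB0; rewrite inE eqxx.
  exists (Num.min xi q.2); split; [by rewrite lt_min xi0|by rewrite ge_min xz|].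
  by move=> q'; rewrite inE ge_min => /predU1P[->|/xS->]; rewrite ?lexx ?orbT.
set V := V0 `\` [set x | exists2 q, q \in S & mdist q.1 x < 2 * q.2].
have muV : mu <= m V by exact: mass.
have xi2 : 0 < xi / 2 by rewrite divr_gt0.
have [n1 n1P] := limsup_radius_small b_gt0 tau_gt0 tau_b (ltac:(by rewrite invr_gt0) : 0 < 8^-1).
have [n2 n2P] := @natS_powRN_small R b^-1 (xi / 8) (ltac:(by rewrite invr_gt0)) (ltac:(by rewrite divr_gt0)).
pose n' := maxn (maxn n nst) (maxn n1 n2).
have [u [fu su]] := fam V n' xi2.
have BP' q : (B0 `&` ~` [set` S]) q -> [/\ 0 < q.2, q.2 <= 1 & 2 * q.2 < r0].
  by move=> [/B0B/BP].
have nst' : (nst <= n')%N by rewrite /n' !leq_max leqnn orbT.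
have tail' : (\esum_(q in B0 `&` ~` [set` S]) (q.2 `^ t)%:E <
    (cst * \sum_(p <- u) D p.2 `^ s)%:E)%E.
  apply: lt_le_trans tail _; rewrite lee_fin ler_pM2l //; apply: le_trans su.
  by rewrite ler_pM2l.
have [l [j [v' [nj Ajl [v [V0v nSv] vv'] v'l lightl]]]] := cand _ _ _ _ nst' fu BP' tail'.
have [njn n1j n2j] : [/\ (n <= j)%N, (n1 <= j)%N & (n2 <= j)%N].
  by split; apply: leq_trans nj; rewrite /n' !leq_max leqnn ?orbT.
have Dj : D j < xi / 8 by exact: n2P.
have dlj : 8 * dl j <= D j by rewrite -ler_pdivlMl //; exact: n1P.
have near_v x : mdist l x <= dl j -> mdist v x < xi.
  move=> lx; apply: (arith _ _ _ _ _ _ xi0 vv' (lt_trans v'l Dj) lx (le_trans dlj (ltW Dj))).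
  apply: le_trans (metric_triangle v l x) _; rewrite lerD2r.
  exact: metric_triangle.
exists (l, j); split => //=; last first.
  by exists v => // x /near_v/lt_le_trans; apply.
(* Lightness was obtained for [B0] without [S]; it holds for [B], as a ball of [B] meeting the
   candidate is in [B0] by proximity and not in [S]. *)
apply: le_trans lightl; apply: le_esum_set => q [Bq [x lx qx]].
have vx : mdist v x < xi by exact/near_v/ltW.
split; last by exists x.
split; first exact: (nbhd q v x) (lt_le_trans vx xizeta) qx.
move=> /= qS; apply: nSv; exists q => //.
apply: (arith2 _ _ _ _ _ (xiS q qS) (metric_triangle q.1 x v) qx).
by rewrite metric_sym.
Qed.

End limsup.
End mass_transference.

(** * Nested lightly covered balls and infinite measure *)

Section limsup_infinite_measure.
Context {R : realType} {X : metricType R}.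
Context (s c1 c2 r0 a b tau : R).
Local Notation H := (@hausdorff_measure R X s).
Local Notation m := (fun A : set X => fine (H A)).
Context (c1_gt0 : 0 < c1) (c2_gt0 : 0 < c2) (r0_gt0 : 0 < r0)
  (a_ge0 : 0 <= a) (b_gt0 : 0 < b) (sE : s = a + b)
  (tau_gt0 : 0 < tau) (tau_b : tau^-1 < b)
  (HX : H setT = 1%E)
  (ahlfors : forall (x : X) (r : R), 0 < r < r0 ->
     ((c1 * r `^ s)%:E <= H (ball x r) <= (c2 * r `^ s)%:E)%E).
Local Notation t := (a + tau^-1).
Local Notation D := (critical_radius b).
Local Notation dl := (limsup_radius tau).

Let pow0 (x p : R) : 0 < x -> 0 < x `^ p. Proof. exact: powR_gt0. Qed.

Let t_gt0 : 0 < t.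
Proof. by rewrite ltr_wpDl // invr_gt0. Qed.

Let t_lt_s : t < s.
Proof. by rewrite sE ltrD2l. Qed.

Lemma powR_le_scale (x r eps : R) : 0 < x -> 0 < r -> eps <= 1 ->
  x `^ t <= eps * r `^ t -> x <= r.
Proof.
move=> x0 r_gt0 eps1 h; rewrite leNgt; apply/negP => rx.
have : r `^ t < x `^ t by apply: gt0_ltr_powR => //; rewrite nnegrE ltW.
rewrite ltNge => /negP; apply; apply: le_trans h _.
by rewrite ler_piMl // powR_ge0.
Qed.

Lemma sum_powR_le (S : seq (X * R)) (r : R) : 0 < r ->
  (forall q, q \in S -> 0 < q.2 <= r) ->
  \sum_(q <- S) q.2 `^ s <= r `^ (s - t) * \sum_(q <- S) q.2 `^ t.
Proof.
move=> r_gt0 SP; rewrite mulr_sumr big_seq [leRHS]big_seq.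
apply: ler_sum => q /SP/andP[q0 qr].
have -> : q.2 `^ s = q.2 `^ (s - t) * q.2 `^ t.
  by rewrite -powRD ?(gt_eqF q0) ?implybT // subrK.
apply: ler_wpM2r; first exact: powR_ge0.
by apply: ge0_ler_powR; rewrite ?nnegrE ?subr_ge0 ?(ltW t_lt_s) ?(ltW q0) ?(ltW r_gt0).
Qed.

Context (A : nat -> set X) (cl Cu rm k1 : R).
Context (cl_gt0 : 0 < cl) (Cu_gt0 : 0 < Cu) (rm_gt0 : 0 < rm) (k1_gt0 : 0 < k1)
  (lowA : forall j, lower_nets a cl rm (A j))
  (uppA : forall j, upper_nets a Cu rm (A j))
  (fam : forall (V : set X) (eta : R) (n : nat), 0 < eta ->
    exists u, ball_family b A [set z | exists2 v, V v & mdist v z < eta] n u /\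
      k1 * m V <= \sum_(p <- u) critical_radius b p.2 `^ s).

(** Chosen so that the doubled balls of a light cover use up at most half of the lower bound for the
    measure of the concentric ball of half radius. *)
Let eps := Num.min 1 (c1 * 2^-1 `^ s / 2 / (c2 * 2 `^ s)).

Let eps_gt0 : 0 < eps.
Proof. by rewrite lt_min ltr01 /= !(mulr_gt0, invr_gt0) // pow0. Qed.

Let eps_le1 : eps <= 1.
Proof. by rewrite ge_min lexx. Qed.

(** The new ball is sought near the ball of half radius, with margin r/2, so that its closed version
    lies in the old open ball. *)
Lemma light_step (B : set (X * R)) (p : X * nat) :
  (forall q, B q -> [/\ 0 < q.2, q.2 <= 1 & 2 * q.2 < r0]) ->
  dl p.2 < r0 -> lightly_covered a tau B eps p ->
  exists p' : X * nat, [/\ (p.2 < p'.2)%N, A p'.2 p'.1, lightly_covered a tau B eps p' &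
    forall x, mdist p'.1 x <= dl p'.2 -> mdist p.1 x < dl p.2].
Proof.
move=> BP; have : 0 < dl p.2 by exact: limsup_radius_gt0.
rewrite /lightly_covered; move: (dl p.2) => r r_gt0 rr0 lightp.
have arith1 : 0 < r / 2 < r0.
  by have h0 : 0 < r by []; apply/andP; split; lra.
have arith2 (x y z : R) : z <= x + y -> x < r / 2 -> y < r / 2 -> z < r by lra.
have arith3 (x y : R) : x <= y + x / 2 -> x / 2 <= y by lra.
have r2 : 0 < r / 2 by rewrite divr_gt0.
pose B0 := B `&` meets p.1 r.
(* A single ball satisfies q^t <= eps r^t with eps <= 1, so it is no larger than the ball it meets;
   this turns the bound on sums of t-th powers into one on s-th powers. *)
have B0P q : B0 q -> 0 < q.2 <= r.
  move=> B0q; have [/BP[q0 _ _] _] := B0q; rewrite q0 /=.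
  apply: (powR_le_scale q0 r_gt0 eps_le1); rewrite -lee_fin; apply: le_trans lightp.
  have := @esum_ge_seq _ _ (fun q : X * R => q.2 `^ t) B0 [:: q] isT.
  by rewrite big_seq1; apply => q'; rewrite inE => /eqP ->.
have mu0 : 0 < c1 * (r / 2) `^ s / 2 by rewrite divr_gt0 // mulr_gt0 // pow0.
have [|||p' [? ? ? [v pv vP]]] := @exists_lightly_covered _ _ s c1 c2 r0 a b tau c1_gt0 c2_gt0
    a_ge0 b_gt0 sE tau_gt0 tau_b HX ahlfors A cl Cu rm k1 cl_gt0 Cu_gt0 rm_gt0 k1_gt0
    lowA uppA fam B B0 (ball p.1 (r / 2)) (r / 2) (c1 * (r / 2) `^ s / 2) eps p.2.+1
    eps_gt0 eps_le1 BP (@subIsetl _ _ _) r2 mu0.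
- by apply: le_lt_trans lightp _; exact: ltry.
- move=> q v x Bq /ballP pv vx qx; split => //; exists x => //.
  exact: arith2 (metric_triangle p.1 v x) pv vx.
- move=> S uS SB0.
  have SP q : q \in S -> 0 < q.2 /\ 2 * q.2 < r0.
    by move=> /SB0[/BP[]].
  have hS : \sum_(q <- S) q.2 `^ t <= eps * r `^ t.
    rewrite -lee_fin; apply: le_trans lightp.
    exact: (esum_ge_seq (fun q : X * R => q.2 `^ t)).
  have hS' : \sum_(q <- S) q.2 `^ s <= eps * r `^ s.
    apply: le_trans (sum_powR_le r_gt0 (fun q qS => B0P q (SB0 q qS))) _.
    have -> : r `^ s = r `^ (s - t) * r `^ t.
      by rewrite -powRD ?(gt_eqF r_gt0) ?implybT // subrK.
    by rewrite mulrCA ler_wpM2l // powR_ge0.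
  have eps2 : c2 * 2 `^ s * eps <= c1 * 2^-1 `^ s / 2.
    have p2 : 0 < c2 * 2 `^ s by rewrite mulr_gt0 // pow0.
    by rewrite mulrC -ler_pdivlMr // ge_min lexx orbT.
  have hS'' : c2 * 2 `^ s * \sum_(q <- S) q.2 `^ s <= c1 * (r / 2) `^ s / 2.
    apply: (@le_trans _ _ (c2 * 2 `^ s * (eps * r `^ s))).
      by rewrite ler_wpM2l // ltW // mulr_gt0 // pow0.
    rewrite powRM ?invr_ge0 ?(ltW r_gt0) //.
    rewrite [leLHS]mulrA [leRHS](_ : _ = c1 * 2^-1 `^ s / 2 * r `^ s); last by ring.
    by rewrite ler_wpM2r // powR_ge0.
  have h1 := hausdorff_setD_balls HX ahlfors (ball p.1 (r / 2)) SP.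
  have h2 := ahlfors_ge HX ahlfors p.1 arith1.
  apply: arith3; apply: le_trans h2 _; apply: le_trans h1 _.
  by rewrite lerD2l.
exists p'; split => //.
move=> x /vP vx; move/ballP: pv => pv.
exact: arith2 (metric_triangle p.1 v x) pv vx.
Qed.

(** All radii being at most [rho], the doubled balls remove at most half of the total measure 1. *)
Lemma light_start (B : set (X * R)) (rho : R) (n : nat) :
  (forall q, B q -> [/\ 0 < q.2, q.2 <= 1 & 2 * q.2 < r0]) ->
  (forall q, B q -> q.2 <= rho) -> 0 < rho -> (\esum_(q in B) (q.2 `^ t)%:E < +oo)%E ->
  c2 * 2 `^ s * (rho `^ (s - t) * fine (\esum_(q in B) (q.2 `^ t)%:E)%E) <= 2^-1 ->
  exists p : X * nat, [/\ (n <= p.2)%N, A p.2 p.1 & lightly_covered a tau B eps p].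
Proof.
move=> BP Brho rho0 fB small.
have half0 : 0 < 2^-1 :> R by rewrite invr_gt0.
have arith (x y : R) : 1 <= x + y -> y <= 2^-1 -> 2^-1 <= x by lra.
have [||p [? ? ? _]] := @exists_lightly_covered _ _ s c1 c2 r0 a b tau c1_gt0 c2_gt0
    a_ge0 b_gt0 sE tau_gt0 tau_b HX ahlfors A cl Cu rm k1 cl_gt0 Cu_gt0 rm_gt0 k1_gt0
    lowA uppA fam B B setT 1 2^-1 eps n
    eps_gt0 eps_le1 BP (@subset_refl _ _) ltr01 half0 fB.
- by move=> q.
- move=> S uS SB.
  have SP q : q \in S -> 0 < q.2 /\ 2 * q.2 < r0 by move=> /SB/BP[].
  have h1 := hausdorff_setD_balls HX ahlfors setT SP.
  apply: arith (_ : 1 <= _) _; first by move: h1; rewrite HX; apply.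
  apply: le_trans small; apply: ler_wpM2l; first by rewrite mulr_ge0 ?ltW // pow0.
  have SP' q : q \in S -> 0 < q.2 <= rho.
    by move=> /SB Bq; have [-> _ _] := BP _ Bq; exact: Brho.
  apply: le_trans (sum_powR_le rho0 SP') _; apply: ler_wpM2l; first exact: powR_ge0.
  rewrite -lee_fin fineK; first exact: (esum_ge_seq (fun q : X * R => q.2 `^ t)).
  by rewrite ge0_fin_numE //; apply: esum_ge0 => q _; rewrite lee_fin powR_ge0.
by exists p.
Qed.

(** A cluster point of the centres lies in every closed ball, hence, one step earlier, in every open
    ball. *)
Lemma nested_balls_point (f : nat -> X * nat) : compact [set: X] ->
  (forall k x, mdist (f k.+1).1 x <= dl (f k.+1).2 -> mdist (f k).1 x < dl (f k).2) ->
  exists x, forall k, mdist (f k).1 x < dl (f k).2.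
Proof.
move=> cX nest.
have nest' k i x : mdist (f (k + i)%N).1 x <= dl (f (k + i)%N).2 ->
    mdist (f k).1 x <= dl (f k).2.
  elim: i x => [x|i ih x]; first by rewrite addn0.
  by rewrite addnS => /nest/ltW/ih.
have tail k n : (k <= n)%N -> mdist (f k).1 (f n).1 <= dl (f k).2.
  move=> /subnKC <-; apply: (nest' k (n - k)%N); rewrite mdistxx; exact/ltW/limsup_radius_gt0.
have [x [_ clx]] := cX ((fun n => (f n).1) @ \oo) _ filterT.
exists x => k; apply: nest; apply/ler_addgt0Pr => e e0.
have [||y [/= yk /ballP xy]] := clx [set y | mdist (f k.+1).1 y <= dl (f k.+1).2] (ball x e).
- by exists k.+1 => // n /= kn; exact: tail.
- exact: nbhsx_ballx.
apply: le_trans (metric_triangle _ y x) _; apply: lerD => //.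
by rewrite metric_sym ltW.
Qed.

Lemma limsup_hausdorff_infty : compact [set: X] ->
  hausdorff_measure t [set x | infinite_set [set j | Delta (A j) (dl j) x]] = +oo%E.
Proof.
move=> cX; set L := [set x | _].
apply/eqP; rewrite -leye_eq leNgt; apply/negP => Lfin.
have finL : hausdorff_measure t L \is a fin_num.
  by rewrite ge0_fin_numE // hausdorff_measure_ge0.
pose M := fine (hausdorff_measure t L) + 1.
have M0 : 0 < M by rewrite ltr_wpDl ?fine_ge0 ?hausdorff_measure_ge0.
have st0 : 0 < s - t by rewrite subr_gt0.
(* The value for which c2 2^s kap M = 1/2, the bound asked by [light_start]; [rho] is then chosen
   with rho^(s - t) <= kap. *)
pose kap := (c2 * 2 `^ s * M * 2)^-1.
have kap0 : 0 < kap by rewrite invr_gt0 !mulr_gt0 // pow0.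
pose rho := Num.min (Num.min 1 (r0 / 2)) (kap `^ (s - t)^-1).
have rho0 : 0 < rho by rewrite !lt_min ltr01 divr_gt0 // pow0.
have [B [cB Brho LB] sumB] : exists2 B, ball_cover rho L B &
    (\esum_(q in B) (q.2 `^ t)%:E < M%:E)%E.
  have : (hausdorff_content t rho L < M%:E)%E.
    apply: le_lt_trans (hausdorff_content_le t L rho0) _.
    by rewrite -(fineK finL) lte_fin ltrDl.
  by move=> /ereal_inf_lt[_ [B covB <-] h]; exists B.
have BP q : B q -> [/\ 0 < q.2, q.2 <= 1 & 2 * q.2 < r0].
  move=> /Brho/andP[q0]; rewrite !lt_min => /andP[/andP[q1 qr] _].
  by split => //; [exact: ltW|rewrite mulrC -ltr_pdivlMr].
have Bfin : (\esum_(q in B) (q.2 `^ t)%:E < +oo)%E.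
  by apply: lt_trans sumB _; exact: ltry.
have Bge0 : (0 <= \esum_(q in B) (q.2 `^ t)%:E)%E.
  by apply: esum_ge0 => q _; rewrite lee_fin powR_ge0.
have small : c2 * 2 `^ s * (rho `^ (s - t) * fine (\esum_(q in B) (q.2 `^ t)%:E)%E) <= 2^-1.
  apply: (@le_trans _ _ (c2 * 2 `^ s * (kap * M))).
    apply: ler_wpM2l; first by rewrite mulr_ge0 ?(ltW c2_gt0) ?powR_ge0.
    apply: ler_pM; [exact: powR_ge0|exact: fine_ge0| |].
      have -> : kap = (kap `^ (s - t)^-1) `^ (s - t).
        by rewrite -powRrM mulVf ?gt_eqF // powRr1 // ltW.
      apply: ge0_ler_powR; rewrite ?nnegrE ?powR_ge0 ?(ltW rho0) ?(ltW st0) //.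
      by rewrite ge_min lexx orbT.
    by rewrite -lee_fin fineK ?ge0_fin_numE // ltW.
  rewrite le_eqVlt; apply/orP; left; apply/eqP; rewrite /kap.
  have p2 : 0 < 2 `^ s :> R by exact: pow0.
  by field; rewrite !gt_eqF.
have Brho' q : B q -> q.2 <= rho by move=> /Brho/andP[_ /ltW].
(* From [n0] on the radii are below [r0], as [light_step] requires. *)
have [n0 n0P] := natS_powRN_small tau_gt0 r0_gt0.
have [p0 [n0p0 Ap0 lp0]] := light_start n0 BP Brho' rho0 Bfin small.
have /choice[g gP] : forall p : X * nat, exists p', (n0 <= p.2)%N -> lightly_covered a tau B eps p ->
    [/\ (p.2 < p'.2)%N, A p'.2 p'.1, lightly_covered a tau B eps p' &
    forall x, mdist p'.1 x <= dl p'.2 -> mdist p.1 x < dl p.2].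
  move=> p; have [np|np] := leqP n0 p.2; last by exists p.
  have [lp|nlp] := pselect (lightly_covered a tau B eps p); last by exists p.
  by have [p' p'P] := light_step BP (n0P _ np) lp; exists p'.
pose f k := iter k g p0.
have fP k : [/\ (n0 + k <= (f k).2)%N, A (f k).2 (f k).1 & lightly_covered a tau B eps (f k)].
  elim: k => [|k [nk Ak lk]]; first by rewrite addn0.
  have [h1 h2 h3 _] := gP (f k) (leq_trans (leq_addr _ _) nk) lk.
  by split => //; rewrite addnS; exact: leq_ltn_trans nk h1.
have fS k : ((f k).2 < (f k.+1).2)%N /\
    forall x, mdist (f k.+1).1 x <= dl (f k.+1).2 -> mdist (f k).1 x < dl (f k).2.
  have [nk Ak lk] := fP k.
  by have [h1 _ _ h2] := gP (f k) (leq_trans (leq_addr _ _) nk) lk.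
have [x xP] := nested_balls_point cX (fun k => (fS k).2).
(* The indices strictly increase along the construction, so the common point is close to infinitely
   many of the sets. *)
have Lx : L x.
  apply/infinite_set_natP => N; have [nN AN _] := fP N.
  exists (f N).2; first by apply: leq_trans nN; exact: leq_addl.
  by apply/DeltaP; exists (f N).1 => //; rewrite metric_sym.
have [q Bq /ballP qx] := LB _ Lx.
have [q0 _ _] := BP _ Bq.
have taut : 0 < tau * t by rewrite mulr_gt0.
have [N NP] := natS_powRN_small taut (pow0 t q0).
have [nN _ lN] := fP N.
(* The ball [q] containing [x] meets every ball of the chain, so its radius is bounded by radii
   tending to 0. *)
have : q.2 `^ t <= eps * dl (f N).2 `^ t.
  rewrite -lee_fin; apply: le_trans lN.
  have := @esum_ge_seq _ _ (fun q : X * R => q.2 `^ t) (B `&` meets (f N).1 (dl (f N).2)) [:: q] isT.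
  rewrite big_seq1; apply => q'; rewrite inE => /eqP ->; split => //.
  by exists x; first exact: xP.
apply/negP; rewrite -ltNge.
apply: le_lt_trans (_ : dl (f N).2 `^ t < _).
  by rewrite ler_piMl // powR_ge0.
rewrite /limsup_radius -powRrM mulNr; apply: NP.
by apply: leq_trans nN; exact: leq_addl.
Qed.

End limsup_infinite_measure.

(** * The upper bound, and the theorem *)

Section natural_power_sums.
Context {R : realType}.

(** With x = y + 1, the bounds 1 + sigma/x <= exp(sigma/x) and ln y - ln x <= -1/x give (1 +
    sigma/x) x^(-sigma) <= y^(-sigma). Summed, it is a discrete integral comparison. *)
Lemma natS_powRN_telescope (sigma : R) (j : nat) : 0 < sigma ->
  sigma * j.+2%:R `^ (- (1 + sigma)) + j.+2%:R `^ (- sigma) <= j.+1%:R `^ (- sigma).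
Proof.
move=> sigma0.
have : 1 <= j.+1%:R :> R by rewrite ler1n.
rewrite -[j.+2%:R]natr1; move: (j.+1%:R : R) => y y1.
set x := y + 1.
have y0 : 0 < y by lra.
have x0 : 0 < x by rewrite /x; lra.
have lnx : ln y - ln x <= - x^-1.
  rewrite -ln_div ?posrE // (_ : y / x = 1 + - x^-1); last first.
    by rewrite /x; field; rewrite gt_eqF.
  apply: le_ln1Dx; rewrite ltrN2 invf_lt1 // /x; lra.
rewrite opprD powRD ?(gt_eqF x0) ?implybT // powR_inv1 ?(ltW x0) // mulrA.
rewrite -[X in _ + X]mul1r -mulrDl.
rewrite /powR !gt_eqF //.
apply: (@le_trans _ _ (expR (sigma / x) * expR (- sigma * ln x))).
  by rewrite ler_wpM2r ?expR_ge0 // addrC expR_ge1Dx.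
rewrite -expRD ler_expR.
have := ler_wpM2l (ltW sigma0) lnx; rewrite mulrBr mulrN; lra.
Qed.

Lemma natS_powRN_sum (sigma : R) (n N : nat) : 0 < sigma ->
  \sum_(n.+1 <= j < N) j.+1%:R `^ (- (1 + sigma)) <= sigma^-1 * n.+1%:R `^ (- sigma).
Proof.
move=> sigma0; have [Nn|nN] := leqP N n.+1.
  by rewrite big_geq // mulr_ge0 ?powR_ge0 // invr_ge0 ltW.
rewrite -(subnKC (ltnW nN)); move: (N - n.+1)%N => k {nN}.
suff : sigma * (\sum_(n.+1 <= j < n.+1 + k) j.+1%:R `^ (- (1 + sigma))) +
    (n.+1 + k)%:R `^ (- sigma) <= n.+1%:R `^ (- sigma).
  move=> h; rewrite -ler_pdivrMl ?invr_gt0 // invrK; apply: le_trans h.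
  by rewrite lerDl powR_ge0.
elim: k => [|k ih]; first by rewrite addn0 big_geq // mulr0 add0r.
rewrite addnS big_nat_recr ?leq_addr //= mulrDr -addrA; apply: le_trans ih.
by rewrite lerD2l !addSn natS_powRN_telescope.
Qed.

End natural_power_sums.

(** * Null measure above the critical exponent *)

Section limsup_null.
Context {R : realType} {X : metricType R}.
Context (s c1 c2 r0 a tau : R).
Local Notation H := (@hausdorff_measure R X s).
Context (c1_gt0 : 0 < c1) (r0_gt0 : 0 < r0) (a_ge0 : 0 <= a) (tau_gt0 : 0 < tau)
  (HX : H setT = 1%E)
  (ahlfors : forall (x : X) (r : R), 0 < r < r0 ->
     ((c1 * r `^ s)%:E <= H (ball x r) <= (c2 * r `^ s)%:E)%E).
Local Notation dl := (limsup_radius tau).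

(** For radii below 1 a larger exponent gives smaller powers, and lowering the scale to min(rho, 1)
    only raises the content. *)
Lemma le_hausdorff_measure_exp (p q : R) (L : set X) : p <= q ->
  (hausdorff_measure q L <= hausdorff_measure p L)%E.
Proof.
move=> pq; apply: hausdorff_measure_le => rho rho0.
pose r := Num.min rho 1.
have r_gt0 : 0 < r by rewrite lt_min rho0 ltr01.
apply: (@le_trans _ _ (hausdorff_content q r L)).
  by apply: ge_hausdorff_content; rewrite ge_min lexx.
apply: le_trans (hausdorff_content_le p L r_gt0).
apply: le_ereal_inf_tmp => _ [B [cB Br LB] <-].
apply: (@le_trans _ _ (\esum_(x in B) (x.2 `^ q)%:E)%E).
  by apply: ereal_inf_lbound; exists B.
apply: le_esum => x /Br/andP[x0]; rewrite lt_min => /andP[_ x1]; rewrite lee_fin.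
rewrite -[q](subrK p) addrC powRD ?(gt_eqF x0) ?implybT // ler_piMr ?powR_ge0 //.
have -> : 1 = 1 `^ (q - p) :> R by rewrite powR1.
by apply: ge0_ler_powR; rewrite ?nnegrE ?subr_ge0 ?ler01 ?(ltW x0) ?(ltW x1).
Qed.

(** The local count becomes global by covering the space with finitely many balls of radius h;
    points in one of them are within 2h < rm of each other. *)
Lemma dispersed_size_le (Cu rm : R) : 0 < Cu -> 0 < rm ->
  exists Cg e0 : R, [/\ 0 < Cg, 0 < e0 & forall (A : set X) (e : R) (ys : seq X),
    upper_nets a Cu rm A -> 0 < e < e0 -> dispersed e ys ->
    (forall y, y \in ys -> A y) -> (size ys)%:R * e `^ a <= Cg].
Proof.
move=> Cu0 rm0; pose h := Num.min r0 rm / 4.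
have h0 : 0 < h by rewrite divr_gt0 // lt_min r0_gt0.
have hr0 : h < r0.
  have : Num.min r0 rm <= r0 by rewrite ge_min lexx.
  by have := h0; rewrite /h => *; lra.
have hrm : 2 * h < rm.
  have : Num.min r0 rm <= rm by rewrite ge_min lexx orbT.
  by have := h0; rewrite /h => *; lra.
have [us [_ _ net]] := exists_net c1_gt0 HX ahlfors setT h0 hr0.
pose K := Cu * (2 * h) `^ a.
have K0 : 0 < K by rewrite mulr_gt0 // powR_gt0 // mulr_gt0.
exists ((size us)%:R * K + 1), h; split=> //; first by rewrite ltr_wpDl // mulr_ge0 // ltW.
move=> A e ys uppA /andP[e0 eh] [uys dys] ysA.
have cluster_le u : (size [seq y <- ys | mdist u y < h])%:R * e `^ a <= K.
  set zs := [seq _ <- _ | _].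
  have zsP z : z \in zs -> z \in ys /\ mdist u z < h by rewrite mem_filter => /andP[].
  have [->|[z0 z0s]] : zs = [::] \/ exists z, z \in zs.
  - by case: zs {zsP} => [|z zs]; [left|right; exists z; rewrite inE eqxx].
  - by rewrite mul0r ltW.
  apply: (uppA z0) => //.
  - exact: ysA (zsP _ z0s).1.
  - by apply/andP; split => //; lra.
  - split; first exact: filter_uniq.
    by move=> x y /zsP[xs _] /zsP[ys' _]; exact: dys.
  move=> z zzs; have [zys uz] := zsP _ zzs; split; first exact: ysA.
  have := (zsP _ z0s).2; have := metric_triangle z0 u z; rewrite (metric_sym z0 u); lra.
have sz : (size ys <= \sum_(u <- us) size [seq y <- ys | (mdist u y < h)%R])%N.
  rewrite -[size ys]count_predT -sum1_count.
  under [leqRHS]eq_bigr do rewrite size_filter -sum1_count big_mkcond.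
  rewrite exchange_big /=; apply: leq_sum => y _.
  have [u uus uy] := net y I.
  by rewrite (big_rem u) //= uy leq_addr.
apply: (@le_trans _ _ ((\sum_(u <- us) size [seq y <- ys | (mdist u y < h)%R])%N%:R * e `^ a)).
  by rewrite ler_wpM2r ?powR_ge0 // ler_nat.
rewrite natr_sum mulr_suml; apply: (@le_trans _ _ (\sum_(u <- us) K)).
  by apply: ler_sum => u _; exact: cluster_le.
by rewrite big_const_seq count_predT iter_addr_0 -(mulr_natl K) lerDl.
Qed.

(** For every n the neighbourhoods of index beyond n cover the limsup set, and each needs of order
    dl^(-a) balls of radius 2 dl. The q-sums are tails of a convergent series. *)
Lemma limsup_hausdorff_zero (A : nat -> set X) (Cu rm q : R) : 0 < Cu -> 0 < rm ->
  (forall j, upper_nets a Cu rm (A j)) -> a + tau^-1 < q ->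
  hausdorff_measure q [set x | infinite_set [set j | Delta (A j) (dl j) x]] = 0%E.
Proof.
move=> Cu0 rm0 uppA tq; set L := [set x | _].
have [Cg [e0 [Cg0 e0_gt0 hCg]]] := dispersed_size_le Cu0 rm0.
have q0 : 0 <= q by apply: le_trans (ltW tq); rewrite addr_ge0 // invr_ge0 ltW.
(* The excess over 1 of the exponent in the series of (j+1)^(-tau (q - a)), positive exactly because
   q > a + 1/tau. *)
pose sigma := tau * (q - a) - 1.
have sigma0 : 0 < sigma.
  by rewrite subr_gt0 -ltr_pdivrMl // mulr1 ltrBrDl.
have tauE : tau * (q - a) = 1 + sigma by rewrite /sigma; ring.
have content_Delta (rho : R) j : 2 * dl j < rho -> dl j < e0 -> dl j < r0 ->
    (hausdorff_content q rho (Delta (A j) (dl j)) <=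
      (Cg * 2 `^ q * j.+1%:R `^ (- (1 + sigma)))%:E)%E.
  have -> : j.+1%:R `^ (- (1 + sigma)) = dl j `^ (q - a).
    by rewrite /limsup_radius -powRrM mulNr tauE.
  have := limsup_radius_gt0 tau j; move: (dl j) => delta d0 drho de0 dr0.
  have [ys [dys ysA net]] := exists_net c1_gt0 HX ahlfors (A j) d0 dr0.
  have de : 0 < delta < e0 by rewrite d0.
  have sz := hCg _ _ _ (uppA j) de dys ysA.
  have cov : Delta (A j) delta `<=` \big[setU/set0]_(y <- ys) ball y (2 * delta).
    move=> x /DeltaP[z Az xz]; have [y yys yz] := net z Az.
    rewrite -bigcup_seq; exists y => //; apply/ballP.
    have := metric_triangle y z x; rewrite (metric_sym z x); lra.
  apply: le_trans (le_hausdorff_content q rho cov) _.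
  apply: (@le_trans _ _ (\sum_(y <- ys) ((2 * delta) `^ q)%:E)%E).
    elim: ys {dys ysA net sz cov} => [|y ys ih].
      by rewrite !big_nil hausdorff_content0.
    rewrite !big_cons; apply: le_trans (outer_measureU2 _ _ _) _; apply: leeD => //.
    by apply: hausdorff_content_ball; rewrite mulr_gt0.
  rewrite sumEFin lee_fin big_const_seq count_predT iter_addr_0.
  rewrite -(mulr_natl ((2 * delta) `^ q)).
  rewrite powRM ?(ltW d0) //.
  have -> : delta `^ q = delta `^ a * delta `^ (q - a).
    by rewrite -powRD ?(gt_eqF d0) ?implybT // addrC subrK.
  rewrite -[leRHS]mulrA; set u := delta `^ (q - a).
  have -> : (size ys)%:R * (2 `^ q * (delta `^ a * u)) =
      (size ys)%:R * delta `^ a * (2 `^ q * u) by ring.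
  by rewrite ler_wpM2r // mulr_ge0 // powR_ge0.
apply/eqP; rewrite eq_le hausdorff_measure_ge0 andbT.
apply: hausdorff_measure_le => rho rho0.
apply/lee_addgt0Pr => e e_gt0; rewrite add0e.
pose small := Num.min (rho / 2) (Num.min e0 r0).
have small0 : 0 < small by rewrite !lt_min divr_gt0 // e0_gt0.
have [n1 n1P] := natS_powRN_small tau_gt0 small0.
pose K := Cg * 2 `^ q.
have K0 : 0 < K by rewrite mulr_gt0 // powR_gt0.
have e2 : 0 < e / K * sigma by rewrite mulr_gt0 // divr_gt0.
have [n2 n2P] := natS_powRN_small sigma0 e2.
pose n := maxn n1 n2.
apply: (@le_trans _ _ (hausdorff_content q rho
    (\bigcup_(j in ~` `I_n.+1) Delta (A j) (dl j)))).
  apply: le_hausdorff_content => x /infinite_set_natP/(_ n.+1)[j nj Dj].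
  by exists j => //=; apply/negP; rewrite -leqNgt.
apply: le_trans (outer_measure_sigma_subadditive_tail _ _ _) _.
apply: lime_le.
  by apply: is_cvg_nneseries => *; exact: hausdorff_content_ge0.
apply: nearW => N.
apply: (@le_trans _ _ (\sum_(n.+1 <= j < N) (K * j.+1%:R `^ (- (1 + sigma)))%:E)%E).
  rewrite big_nat [leRHS]big_nat; apply: lee_sum => j /andP[nj _].
  have : dl j < small.
    by apply: n1P; apply: leq_trans (ltnW nj); exact: leq_maxl.
  rewrite !lt_min => /andP[h1 /andP[h2 h3]].
  by apply: content_Delta => //; rewrite mulrC -ltr_pdivlMr.
rewrite sumEFin lee_fin -mulr_sumr mulrC -ler_pdivlMr //.
apply: le_trans (natS_powRN_sum n N sigma0) _.
rewrite ler_pdivrMl // mulrC; apply/ltW/n2P; exact: leq_maxr.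
Qed.

End limsup_null.

(* Positions are numbered from 0: index j stands for the positive integer j + 1,
   so the sequence (j^{-tau})_{j >= 1} is j |-> (j + 1)^{-tau}. *)
Theorem theorem2 (R : realType) (X : metricType R) (s kappa tau : R)
    (F : nat -> set X) (Phi : set (X -> X))
    (d : measure_display) (Omega : measurableType d) (P : probability Omega R)
    (phi : Omega -> nat -> X -> X) :
  compact [set: X] ->
  0 < s ->
  hausdorff_measure s [set: X] = 1%E ->
  (exists c1 c2 r0 : R, [/\ 0 < c1 < 1, 1 < c2, 0 < r0 &
     forall (x : X) (r : R), 0 < r < r0 ->
       ((c1 * r `^ s)%:E <= hausdorff_measure s (ball x r)
          <= (c2 * r `^ s)%:E)%E]) ->
  (forall j, F j !=set0) ->
  0 <= kappa < 1 ->
  local_scaling_property s kappa F ->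
  (forall f, Phi f -> is_isometry f) ->
  (forall w j, Phi (phi w j)) ->
  (forall (x : X) (j : nat), \forall delta \near 0^'+,
     let E := [set w | Delta (phi w j @` F j) delta x] in
     measurable E /\ P E = hausdorff_measure s (Delta (F j) delta)) ->
  (forall x : X, exists2 delta0 : R, 0 < delta0 &
     forall delta : nat -> R, (forall j, 0 < delta j < delta0) ->
     independent_events P
       (fun j => [set w | Delta (phi w j @` F j) (delta j) x])) ->
  (s - kappa * s)^-1 < tau ->
  {ae P, forall w,
    hausdorff_dim (Lambda F (phi w) (fun j => j.+1%:R `^ (- tau)))
      = (kappa * s + tau^-1)%:E /\
    hausdorff_measure (kappa * s + tau^-1)
      (Lambda F (phi w) (fun j => j.+1%:R `^ (- tau))) = +oo%E}.
Proof.
move=> cX s0 HX [c1 [c2 [r0 [/andP[c10 _] c2_gt1 r00 ahlfors]]]] F0 /andP[k0 k1] lsp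
  iso Phiphi law indep taubig.
have c20 : 0 < c2 by apply: lt_trans c2_gt1; exact: ltr01.
pose a := s * kappa; pose b := s * (1 - kappa).
have sE : s = a + b by rewrite /a /b; ring.
have a0 : 0 <= a by rewrite mulr_ge0 // ltW.
have b0 : 0 < b by rewrite mulr_gt0 // subr_gt0.
have sb : s - kappa * s = b by rewrite /b; ring.
have tau0 : 0 < tau by apply: lt_trans taubig; rewrite sb invr_gt0.
have tau_b : tau^-1 < b by move: taubig; rewrite sb => h; rewrite invf_plt.
have -> : kappa * s = a by rewrite /a mulrC.
have [cl [Cu [rm [cl0 Cu0 rm0 nets]]]] := lsp_nets c10 c20 r00 HX ahlfors lsp.
pose A w j := phi w j @` F j.
have lowA w j : lower_nets a cl rm (A w j).
  by apply: isometry_lower_nets (nets j).1; exact/iso/Phiphi.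
have uppA w j : upper_nets a Cu rm (A w j).
  by apply: isometry_upper_nets (nets j).2; exact/iso/Phiphi.
(* The hitting probability is the measure of a neighbourhood of F_j, bounded below by the scaling
   property at the fixed radius r1/2 about one point of F_j. *)
have [c' c'0 lawA] : exists2 c', 0 < c' & forall j x, \forall delta \near 0^'+,
    measurable [set w | Delta (A w j) delta x] /\
    c' * delta `^ b <= fine (P [set w | Delta (A w j) delta x]).
  have [c3 [c4 [r1 [c30 _ r10 lspF]]]] := lsp.
  exists (c3 * (r1 / 2) `^ a); first by rewrite mulr_gt0 // powR_gt0 // divr_gt0.
  move=> j x; have [f Ff] := F0 j; have r20 : 0 < r1 / 2 by rewrite divr_gt0.
  have small : \forall delta \near 0^'+, 0 < delta < r1 / 2.
    by near=> delta; apply/andP; split.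
  apply: filterS2 small (law x j) => delta /andP[delta0 delta1] [mE PE].
  split => //; rewrite -lee_fin fineK ?fin_num_measure // PE.
  have hr : 0 < r1 / 2 < r1 by apply/andP; split; lra.
  have hd : 0 <= delta < r1 / 2.
    by rewrite ltW.
  have /andP[+ _] := lspF (r1 / 2) delta j f hr hd Ff.
  rewrite mulrAC => /le_trans; apply.
  by apply: le_hausdorff_measure; exact: subIsetr.
have [ch [rh [ch0 rh0 hit]]] :=
  hitting_probability_ge P c10 c20 r00 sE HX ahlfors Cu0 c'0 rm0.
have [k2 k20 likely] := ball_family_likely c10 c20 r00 b0 HX ahlfors ch0 rh0
  (fun j => hit (fun w => A w j) (fun w => uppA w j) (lawA j)) indep.
have ae := ae_ball_family c10 HX ahlfors likely.
apply: filterS ae => w fam.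
have [k3 k30 famV] := ball_family_of_set c10 c20 r00 b0 HX ahlfors k20 fam.
have infty := limsup_hausdorff_infty c10 c20 r00 a0 b0 sE tau0 tau_b HX ahlfors
  cl0 Cu0 rm0 k30 (lowA w) (uppA w) famV cX.
split; last exact: infty.
have zero q := @limsup_hausdorff_zero _ _ _ _ _ _ _ _ c10 r00 a0 tau0 HX ahlfors (A w) _ _ q Cu0 rm0 (uppA w).
apply/eqP; rewrite eq_le; apply/andP; split.
  apply/lee_addgt0Pr => e e0; apply: ereal_inf_lbound; exists (a + tau^-1 + e) => //.
  split; first by rewrite !addr_ge0 ?invr_ge0 // ltW.
  by apply: zero; rewrite ltrDl.
(* An exponent below the critical one with measure zero would, by monotonicity in the exponent,
   contradict the infinite measure. *)
apply: le_ereal_inf_tmp => _ [q [q0 Hq] <-]; rewrite lee_fin leNgt; apply/negP => qt.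
have := le_hausdorff_measure_exp (Lambda F (phi w) (fun j => j.+1%:R `^ (- tau))) (ltW qt).
by rewrite Hq [X in (X <= _)%E]infty.
Unshelve. all: by end_near. Qed.
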